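(* (1) Let $G$ be an ordered groupoid with a maximum identity. Then $\mathbf{L}(G)$ is a left rooted category and $\mathbf{G}^{l}(\mathbf{L}(G))$ is isomorphic to $G$. (2) Let $C$ be a left rooted category. Then $\mathbf{G}^{l}(C)$ is an ordered groupoid with a maximum identity, and $\mathbf{L}(\mathbf{G}^{l}(C))$ is a left rooted category equivalent to $C$. (3) Each inverse monoid with zero is determined by a left cancellative category with a weak terminal identity that has all allowable pullbacks. (4) Each inverse monoid is determined by a left cancellative category with a weak terminal identity that has all pullbacks.
   Context: A category is regarded as a set of arrows with a partial product; $C_o$ is its set of identities, $\mathbf{d}(x)$ and $\mathbf{r}(x)$ are the domain and range identities of $x$, and $xy$ is defined (written $\exists xy$) iff $\mathbf{d}(x)=\mathbf{r}(y)$. A groupoid is a category in which every arrow is invertible. Two categories are equivalent if there is a full, faithful and essentially surjective functor between them. An ordered groupoid is a groupoid $G$ with a partial order $\leq$ on the set $G$ such that: (i) $x\leq y$ implies $x^{-1}\leq y^{-1}$; (ii) if $x\leq y$, $u\leq v$, $\exists xu$ and $\exists yv$ then $xu\leq yv$; (iii) if $e$ is an identity with $e\leq\mathbf{d}(x)$ then there is a unique element $(x\,|\,e)$ with $(x\,|\,e)\leq x$ and $\mathbf{d}(x\,|\,e)=e$; (iv) if $e$ is an identity with $e\leq\mathbf{r}(x)$ then there is a unique element $(e\,|\,x)$ with $(e\,|\,x)\leq x$ and $\mathbf{r}(e\,|\,x)=e$. An isomorphism of ordered groupoids is a bijective order-preserving functor whose inverse is an order-preserving functor. A maximum identity is an identity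 $1$ with $e\leq 1$ for every identity $e$. If $x,y\in G$ and $e=\mathbf{d}(x)\wedge\mathbf{r}(y)$ exists in $G_o$, the pseudoproduct is $x\otimes y=(x\,|\,e)(e\,|\,y)$. $G$ is inductive if $G_o$ is a meet-semilattice; then $(G,\otimes)$ is an inverse semigroup. $G$ is $\ast$-inductive if any two identities with a lower bound have a greatest lower bound; then $G^{0}=G\cup\{0\}$, with $s\otimes t=0$ whenever $s\otimes t$ is undefined in $G$ and all products with $0$ equal to $0$, is an inverse semigroup with zero. For an ordered groupoid $G$, $\mathbf{L}(G)=\{(e,x)\in G_o\times G:\mathbf{r}(x)\leq e\}$, with $\mathbf{d}(e,x)=(\mathbf{d}(x),\mathbf{d}(x))$, $\mathbf{r}(e,x)=(e,e)$, and $(e,x)(f,y)=(e,x\otimes y)$ when $\mathbf{d}(x)=f$. A category is left cancellative if $xy=xz$ implies $y=z$. A weak terminal identity in a category is an identity $1$ such that for each identity $e$ there is an arrow from $e$ to $1$. A left rooted category is a left cancellative category with a weak terminal identity $1$ (for $\mathbf{L}(G)$ in (1) it is $(1,1)$). It has all allowable pullbacks if whenever $\mathbf{r}(a)=\mathbf{r}(b)$ and $aa'=bb'$ for some $a',b'$, then $a$ and $b$ have a pullback; it has all pullbacks if any $a,b$ with $\mathbf{r}(a)=\mathbf{r}(b)$ have a pullback. For a left rooted category $C$, let $U=\{(a,b)\in C\times C:\mathbf{d}(a)=\mathbf{d}(b),\ \mathbf{r}(a)=1=\mathbf{r}(b)\}$, with $(a,b)\sim(a',b')$ iff $(a,b)=(a'u,b'u)$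 for some isomorphism $u$ of $C$. $\mathbf{G}^{l}(C)$ is the set of $\sim$-classes $[a,b]$, with $\mathbf{d}[a,b]=[b,b]$, $\mathbf{r}[a,b]=[a,a]$, $[a,b]^{-1}=[b,a]$; if $\mathbf{d}[a,b]=\mathbf{r}[c,d]$ then $b=cu$ for an isomorphism $u$ and $[a,b]\cdot[c,d]=[a,du]$; and $[a,b]\leq[c,d]$ iff $(a,b)=(cp,dp)$ for some $p\in C$. If $C$ has all allowable pullbacks then $\mathbf{G}^{l}(C)$ is $\ast$-inductive, and adjoining a zero gives an inverse monoid with zero; if $C$ has all pullbacks then $\mathbf{G}^{l}(C)$ is inductive. An inverse semigroup $S$ is regarded as an ordered groupoid under the restricted product ($s\cdot t=st$, defined iff $s^{-1}s=tt^{-1}$) and the natural partial order ($s\leq t$ iff $s=te$ for some idempotent $e$). For an inverse monoid with zero, the left rooted category associated with it is $\mathbf{L}$ of the ordered groupoid of its non-zero elements. *)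

(* Defs.v *)
From mathcomp Require Import all_boot.
From mathcomp Require Import boolp classical_sets.

Set Implicit Arguments.
Unset Strict Implicit.
Unset Printing Implicit Defensive.

Local Open Scope classical_set_scope.

(* Records ending in "arrows" carry data only; the axioms are the predicates   *)
(* [category], [ordered_groupoid], and so on. The partial product is given by  *)
(* its graph: [cmul x y z] means that xy is defined and equal to z.            *)
Record arrows := Arrows {
  arr :> Type;
  dom : arr -> arr;
  ran : arr -> arr;
  cmul : arr -> arr -> arr -> Prop }.

Definition identity (C : arrows) (e : C) : Prop :=
  (forall x z : C, cmul e x z -> z = x) /\ (forall x z : C, cmul x e z -> z = x).

Record category (C : arrows) : Prop := Category {
  cmul_fun : forall x y z z' : C, cmul x y z -> cmul x y z' -> z = z';
  cmul_def : forall x y : C, (exists z, cmul x y z) <-> dom x = ran y;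
  dom_identity : forall x : C, identity (dom x);
  ran_identity : forall x : C, identity (ran x);
  cmul_dom : forall x : C, cmul x (dom x) x;
  cmul_ran : forall x : C, cmul (ran x) x x;
  dom_cmul : forall x y z : C, cmul x y z -> dom z = dom y;
  ran_cmul : forall x y z : C, cmul x y z -> ran z = ran x;
  cmulA : forall x y z xy yz w : C,
    cmul x y xy -> cmul y z yz -> (cmul xy z w <-> cmul x yz w) }.

(* y is the inverse of x; the inverse is unique, so it is not part of the data. *)
Definition inverse_of (C : arrows) (x y : C) : Prop :=
  cmul x y (ran x) /\ cmul y x (dom x).

Definition isomorphism (C : arrows) (x : C) : Prop := exists y, inverse_of x y.

Definition groupoid (G : arrows) : Prop :=
  category G /\ forall x : G, isomorphism x.

Record functor (C D : arrows) (F : C -> D) : Prop := Functor {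
  functor_dom : forall x, F (dom x) = dom (F x);
  functor_ran : forall x, F (ran x) = ran (F x);
  functor_cmul : forall x y z, cmul x y z -> cmul (F x) (F y) (F z) }.

Definition full (C D : arrows) (F : C -> D) : Prop :=
  forall (e f : C) (y : D), identity e -> identity f ->
    dom y = F e -> ran y = F f ->
    exists x : C, [/\ dom x = e, ran x = f & F x = y].

Definition faithful (C D : arrows) (F : C -> D) : Prop :=
  forall x y : C, dom x = dom y -> ran x = ran y -> F x = F y -> x = y.

Definition essentially_surjective (C D : arrows) (F : C -> D) : Prop :=
  forall f : D, identity f ->
    exists (e : C) (u : D),
      [/\ identity e, isomorphism u, dom u = F e & ran u = f].

Definition equivalent (C D : arrows) : Prop :=
  exists F : C -> D,
    [/\ functor F, full F, faithful F & essentially_surjective F].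

Definition left_cancellative (C : arrows) : Prop :=
  forall x y z w : C, cmul x y w -> cmul x z w -> y = z.

Definition weak_terminal (C : arrows) (one : C) : Prop :=
  identity one /\
  forall e : C, identity e -> exists a : C, dom a = e /\ ran a = one.

(* The weak terminal identity is part of the structure: [Gl] depends on it. *)
Definition left_rooted (C : arrows) (one : C) : Prop :=
  [/\ category C, left_cancellative C & weak_terminal one].

Definition commuting_square (C : arrows) (a b p q : C) : Prop :=
  exists w, cmul a p w /\ cmul b q w.

Definition is_pullback (C : arrows) (a b p q : C) : Prop :=
  commuting_square a b p q /\
  forall p' q' : C, commuting_square a b p' q' ->
    exists! u : C, cmul p u p' /\ cmul q u q'.

Definition has_allowable_pullbacks (C : arrows) : Prop :=
  forall a b : C, ran a = ran b ->
    (exists a' b', commuting_square a b a' b') ->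
    exists p q, is_pullback a b p q.

Definition has_pullbacks (C : arrows) : Prop :=
  forall a b : C, ran a = ran b -> exists p q, is_pullback a b p q.

Record ordered_arrows := OrderedArrows {
  oarr :> arrows;
  ole : oarr -> oarr -> Prop }.

Definition is_restriction (G : ordered_arrows) (x e y : G) : Prop :=
  ole y x /\ dom y = e.

Definition is_corestriction (G : ordered_arrows) (e x y : G) : Prop :=
  ole y x /\ ran y = e.

Record ordered_groupoid (G : ordered_arrows) : Prop := OrderedGroupoid {
  og_groupoid : groupoid G;
  ole_refl : forall x : G, ole x x;
  ole_anti : forall x y : G, ole x y -> ole y x -> x = y;
  ole_trans : forall x y z : G, ole x y -> ole y z -> ole x z;
  ole_inv : forall x y x' y' : G,
    ole x y -> inverse_of x x' -> inverse_of y y' -> ole x' y';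
  ole_cmul : forall x y u v xu yv : G,
    ole x y -> ole u v -> cmul x u xu -> cmul y v yv -> ole xu yv;
  og_restriction : forall x e : G, identity e -> ole e (dom x) ->
    exists! y, is_restriction x e y;
  og_corestriction : forall x e : G, identity e -> ole e (ran x) ->
    exists! y, is_corestriction e x y }.

Definition ordered_isomorphic (G H : ordered_arrows) : Prop :=
  exists (F : G -> H) (F' : H -> G),
    [/\ cancel F F', cancel F' F, functor F & functor F'] /\
    {homo F : x y / ole x y} /\ {homo F' : x y / ole x y}.

Definition maximum_identity (G : ordered_arrows) (one : G) : Prop :=
  identity one /\ forall e : G, identity e -> ole e one.

(* The meet is taken in the poset of identities. *)
Definition is_meet (G : ordered_arrows) (e f m : G) : Prop :=
  [/\ identity m, ole m e, ole m f &
      forall n : G, identity n -> ole n e -> ole n f -> ole n m].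

Definition pseudoproduct (G : ordered_arrows) (x y z : G) : Prop :=
  exists e x' y' : G,
    [/\ is_meet (dom x) (ran y) e, is_restriction x e x',
        is_corestriction e y y' & cmul x' y' z].

Definition inductive (G : ordered_arrows) : Prop :=
  ordered_groupoid G /\
  forall e f : G, identity e -> identity f -> exists m, is_meet e f m.

Definition star_inductive (G : ordered_arrows) : Prop :=
  ordered_groupoid G /\
  forall e f : G, identity e -> identity f ->
    (exists n, [/\ identity n, ole n e & ole n f]) -> exists m, is_meet e f m.

(* The product of G^0, with [None] as the adjoined zero. *)
Definition pseudoproduct0 (G : ordered_arrows) (s t : option G) : option G :=
  match s, t with
  | Some x, Some y =>
      match pselect (exists z, pseudoproduct x y z) with
      | left h => Some (sval (cid h))
      | right _ => None
      end
  | _, _ => None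
  end.

Section LeftCategory.
Variables (G : ordered_arrows) (HG : ordered_groupoid G).

Record Lpair := LPair {
  Lid : G;
  Larr : G;
  Lid_identity : identity Lid;
  Lran_le : ole (ran Larr) Lid }.

Lemma ran_of_identity (e : G) : identity e -> ran e = e.
Proof.
move=> [_ He]; have [HC _] := og_groupoid HG.
by apply/esym/He; exact: (cmul_ran HC).
Qed.

Lemma Ldiag_subproof (e : G) : identity e -> ole (ran e) e.
Proof. by move=> /ran_of_identity ->; exact: (ole_refl HG). Qed.

Definition Ldiag (e : G) (He : identity e) : Lpair :=
  LPair He (Ldiag_subproof He).

Definition Lcat : arrows := {|
  arr := Lpair;
  dom := fun a => Ldiag (dom_identity (proj1 (og_groupoid HG)) (Larr a));
  ran := fun a => Ldiag (Lid_identity a);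
  cmul := fun a b c =>
    [/\ dom (Larr a) = Lid b, Lid c = Lid a &
        pseudoproduct (Larr a) (Larr b) (Larr c)] |}.

End LeftCategory.

Section LeftGroupoid.
Variables (C : arrows) (one : C).

Record Upair := UPair {
  Ufst : C;
  Usnd : C;
  Udom : dom Ufst = dom Usnd;
  Uran1 : ran Ufst = one;
  Uran2 : ran Usnd = one }.

Definition Usim (p q : Upair) : Prop :=
  exists u : C,
    [/\ isomorphism u, cmul (Ufst q) u (Ufst p) & cmul (Usnd q) u (Usnd p)].

Definition Gclass : Type :=
  {X : set Upair | exists p, X = [set q | Usim q p]}.

(* [gclass p] is the class written [a,b] for p = (a,b). *)
Definition gclass (p : Upair) : Gclass :=
  exist _ [set q | Usim q p] (ex_intro _ p erefl).

Definition class_repr (X : Gclass) : Upair := sval (cid (svalP X)).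

Definition Udiag1 (p : Upair) : Upair := UPair erefl (Uran1 p) (Uran1 p).
Definition Udiag2 (p : Upair) : Upair := UPair erefl (Uran2 p) (Uran2 p).

(* The domain [b,b] and range [a,a] are computed on a chosen representative;  *)
(* in a left rooted category they do not depend on the choice. The inverse    *)
(* [b,a] needs no field, since inverses are determined by the product.        *)
Definition Gl_arrows : arrows := {|
  arr := Gclass;
  dom := fun X => gclass (Udiag2 (class_repr X));
  ran := fun X => gclass (Udiag1 (class_repr X));
  cmul := fun X Y Z =>
    exists (p q s : Upair) (u : C),
      [/\ X = gclass p, Y = gclass q & Z = gclass s] /\
      [/\ isomorphism u, cmul (Ufst q) u (Usnd p),
          Ufst s = Ufst p & cmul (Usnd q) u (Usnd s)] |}.

Definition Gl : ordered_arrows := {|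
  oarr := Gl_arrows;
  ole := fun X Y : Gl_arrows =>
    exists (p q : Upair) (t : C),
      [/\ X = gclass p, Y = gclass q,
          cmul (Ufst q) t (Ufst p) & cmul (Usnd q) t (Usnd p)] |}.

End LeftGroupoid.

Record inverse_monoid (S : Type) (mul : S -> S -> S) (one : S) (inv : S -> S) :
    Prop := InverseMonoid {
  im_assoc : associative mul;
  im_left_id : left_id one mul;
  im_right_id : right_id one mul;
  im_mulVK : forall x, mul (mul x (inv x)) x = x;
  im_VmulK : forall x, mul (mul (inv x) x) (inv x) = inv x;
  im_inv_uniq : forall x y,
    mul (mul x y) x = x -> mul (mul y x) y = y -> y = inv x }.

Definition is_zero (S : Type) (mul : S -> S -> S) (zero : S) : Prop :=
  left_zero zero mul /\ right_zero zero mul.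

Definition monoid_isomorphism (S T : Type) (mulS : S -> S -> S) (oneS : S)
    (mulT : T -> T -> T) (oneT : T) (f : S -> T) : Prop :=
  [/\ bijective f, {morph f : x y / mulS x y >-> mulT x y} & f oneS = oneT].

Definition natural_le (S : Type) (mul : S -> S -> S) (s t : S) : Prop :=
  exists e, mul e e = e /\ s = mul t e.

Definition groupoid_of (S : Type) (mul : S -> S -> S) (inv : S -> S) :
    ordered_arrows := {|
  oarr := {|
    arr := S;
    dom := fun s => mul (inv s) s;
    ran := fun s => mul s (inv s);
    cmul := fun s t z => mul (inv s) s = mul t (inv t) /\ z = mul s t |};
  ole := natural_le mul |}.

Section NonZero.
Variables (S : Type) (mul : S -> S -> S) (one : S) (inv : S -> S) (zero : S).
Hypothesis HS : inverse_monoid mul one inv.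
Hypothesis Hzero : is_zero mul zero.

Definition nonzero : Type := {s : S | s <> zero}.

Lemma nonzero_dom_subproof (s : nonzero) :
  mul (inv (sval s)) (sval s) <> zero.
Proof.
case: s => s /= s0 E; apply: s0.
by rewrite -(im_mulVK HS s) -(im_assoc HS) E (proj2 Hzero).
Qed.

Lemma nonzero_ran_subproof (s : nonzero) :
  mul (sval s) (inv (sval s)) <> zero.
Proof.
case: s => s /= s0 E; apply: s0.
by rewrite -(im_mulVK HS s) E (proj1 Hzero).
Qed.

Definition nonzero_groupoid : ordered_arrows := {|
  oarr := {|
    arr := nonzero;
    dom := fun s => exist (fun x => x <> zero) _ (@nonzero_dom_subproof s);
    ran := fun s => exist (fun x => x <> zero) _ (@nonzero_ran_subproof s);
    cmul := fun s t z =>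
      mul (inv (sval s)) (sval s) = mul (sval t) (inv (sval t)) /\
      sval z = mul (sval s) (sval t) |};
  ole := fun s t => natural_le mul (sval s) (sval t) |}.

End NonZero.

(* Main.v *)
(** For a groupoid [G] with maximum identity [1], a pair of arrows
    [((1, x), (1, y))] of [L(G)] with common domain is determined up to
    isomorphism by the quotient [x y^-1], and divisibility of pairs is the order
    of [G] on quotients; this single equivalence makes [[x, y] |-> x y^-1] a
    well-defined order isomorphism.  In the other direction, choose an arrow
    [b : o -> 1] for every identity [[b, b]] of [G^l(C)]: an arrow [(e, X)] of
    [L(G^l(C))] has a unique form [e = [c, c]], [X = [c p, b]] with chosen [b]
    and [c], and [(e, X) |-> p] is an equivalence.  For inverse monoids, idempotents
    commute, so the meet of two identities is their product and the
    pseudoproduct is the original multiplication; a pullback of [(e, x)] and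
    [(e, y)] in [L(G)] comes from the meet of the ranges of [x] and [y]. *)

Require Import Defs.
From mathcomp Require Import all_boot.
From mathcomp Require Import boolp classical_sets.

Set Implicit Arguments.
Unset Strict Implicit.
Unset Printing Implicit Defensive.

(** * Categories and ordered groupoids *)

(** The partial operations are given as relations, along which equations cannot be chained. Each is
    therefore replaced by a total function with an arbitrary default, and every rewriting step
    carries its matching condition on domains and ranges. A composable pair of [L(G)] satisfies
    [ran y <= dom x], so the meet of these identities is [ran y] itself and the composite is
    [otimes x y] in any ordered groupoid. A class of [G^l(C)] has no preferred pair; arguments about
    it run on the relation [represents], where the isomorphism between two pairs is absorbed by
    realigning one of them. The second direction gives only an equivalence because an object of [C]
    may have several arrows to [1] that yield different identities, while isomorphic objects may
    share one. The two monoid statements share one construction: the elements outside an ideal,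
    empty or zero, form an ordered groupoid whose pseudoproduct is the given multiplication wherever
    that stays outside the ideal, and the result is carried back along the order isomorphism. *)

Definition choice_or (T : Type) (x0 : T) (P : T -> Prop) : T :=
  if pselect (exists x, P x) is left h then sval (cid h) else x0.

Lemma choice_orP (T : Type) (x0 : T) (P : T -> Prop) :
  (exists x, P x) -> P (choice_or x0 P).
Proof. by rewrite /choice_or; case: pselect => // h _; case: cid. Qed.

(* Junk value [x] when the product is undefined. *)
Definition cprod (C : arrows) (x y : C) : C := choice_or x (cmul x y).

Local Notation "x ** y" := (cprod x y) (at level 40, left associativity).

Section Category.
Variables (C : arrows) (HC : category C).
Implicit Types x y z e u : C.

Lemma cmul_cprod x y : dom x = ran y -> cmul x y (x ** y).
Proof. by move=> xy; apply: choice_orP; apply/(cmul_def HC). Qed.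

(** The bridge between the relational product and equational reasoning; later computations pass
    through it in both directions. *)
Lemma cmulE x y z : cmul x y z <-> dom x = ran y /\ x ** y = z.
Proof.
split=> [xyz|[xy <-]]; last exact: cmul_cprod.
have xy: dom x = ran y by apply/(cmul_def HC); exists z.
by split=> //; apply: (cmul_fun HC) xyz; exact: cmul_cprod.
Qed.

Lemma dom_cprod x y : dom x = ran y -> dom (x ** y) = dom y.
Proof. by move=> /cmul_cprod/(dom_cmul HC). Qed.

Lemma ran_cprod x y : dom x = ran y -> ran (x ** y) = ran x.
Proof. by move=> /cmul_cprod/(ran_cmul HC). Qed.

Lemma identity_dom e : identity e -> dom e = e.
Proof. by move=> [He _]; apply/esym/He; exact: (cmul_dom HC). Qed.

Lemma identity_ran e : identity e -> ran e = e.
Proof. by move=> [_ He]; apply/esym/He; exact: (cmul_ran HC). Qed.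

Lemma dom_dom x : dom (dom x) = dom x.
Proof. exact/identity_dom/(dom_identity HC). Qed.

Lemma ran_dom x : ran (dom x) = dom x.
Proof. exact/identity_ran/(dom_identity HC). Qed.

Lemma dom_ran x : dom (ran x) = ran x.
Proof. exact/identity_dom/(ran_identity HC). Qed.

Lemma ran_ran x : ran (ran x) = ran x.
Proof. exact/identity_ran/(ran_identity HC). Qed.

Lemma cprod_dom x : x ** dom x = x.
Proof. by have /cmulE [] := cmul_dom HC x. Qed.

Lemma cprod_ran x : ran x ** x = x.
Proof. by have /cmulE [] := cmul_ran HC x. Qed.

Lemma cprodA x y z :
  dom x = ran y -> dom y = ran z -> (x ** y) ** z = x ** (y ** z).
Proof.
move=> xy yz; apply/esym; have := cmulA HC ((x ** y) ** z).
move=> /(_ _ _ _ _ _ (cmul_cprod xy) (cmul_cprod yz)) [H _].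
by apply: (proj2 (proj1 (cmulE _ _ _) _)); apply: H; apply: cmul_cprod;
  rewrite dom_cprod.
Qed.

Lemma cprodI (lc : left_cancellative C) x y z :
  dom x = ran y -> dom x = ran z -> x ** y = x ** z -> y = z.
Proof.
move=> xy xz E; apply: (lc x y z (x ** y)); first exact: cmul_cprod.
by rewrite E; exact: cmul_cprod.
Qed.

Lemma inverse_ofE x y : inverse_of x y <->
  [/\ dom x = ran y, dom y = ran x, x ** y = ran x & y ** x = dom x].
Proof.
split=> [[/cmulE[xy Exy] /cmulE[yx Eyx]]//|[xy yx Exy Eyx]].
by split; apply/cmulE.
Qed.

Lemma inverse_of_uniq x y z : inverse_of x y -> inverse_of x z -> y = z.
Proof.
move=> /inverse_ofE[xy yx _ Eyx] /inverse_ofE[xz zx Exz _].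
by rewrite -[y]cprod_dom yx -Exz -cprodA // Eyx xz cprod_ran.
Qed.

Lemma identity_isomorphism e : identity e -> isomorphism e.
Proof.
move=> He; exists e; have [Ed Er] := (identity_dom He, identity_ran He).
have ee: e ** e = e by rewrite -{2}Ed cprod_dom.
by apply/inverse_ofE; split; rewrite ?Ed ?Er.
Qed.

Lemma inverse_of_sym x y : inverse_of x y -> inverse_of y x.
Proof.
by move=> /inverse_ofE[xy yx Exy Eyx]; apply/inverse_ofE; split; congruence.
Qed.

Lemma isomorphism_cprod x y : dom x = ran y ->
  isomorphism x -> isomorphism y -> isomorphism (x ** y).
Proof.
move=> xy [x' /inverse_ofE[xx' x'x Exx' Ex'x]].
move=> [y' /inverse_ofE[yy' y'y Eyy' Ey'y]].
have y'x': dom y' = ran x' by congruence.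
exists (y' ** x'); apply/inverse_ofE; split.
- by rewrite dom_cprod // ran_cprod.
- by rewrite dom_cprod // ran_cprod.
- rewrite ran_cprod // cprodA ?ran_cprod // -(cprodA yy') // Eyy' -xy xx'.
  rewrite cprod_ran.
  exact: Exx'.
- rewrite dom_cprod // cprodA ?ran_cprod // -(cprodA x'x) // Ex'x xy cprod_ran.
  exact: Ey'y.
Qed.

End Category.

Definition ginv (G : arrows) (x : G) : G := choice_or x (inverse_of x).

Definition res (G : ordered_arrows) (x e : G) : G :=
  choice_or x (is_restriction x e).

Definition cores (G : ordered_arrows) (e x : G) : G :=
  choice_or x (is_corestriction e x).

(* The pseudoproduct [x ⊗ y] in the case [ran y <= dom x]. *)
Definition otimes (G : ordered_arrows) (x y : G) : G := res x (ran y) ** y.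

(** * Restrictions, pseudoproducts and quotients in an ordered groupoid *)

Section OrderedGroupoid.
Variables (G : ordered_arrows) (HG : ordered_groupoid G).
Let HC : category G := proj1 (og_groupoid HG).
Implicit Types x y z e f m : G.

Local Notation cmulE := (cmulE HC).
Local Notation cprodA := (cprodA HC).
Local Notation dom_cprod := (dom_cprod HC).
Local Notation ran_cprod := (ran_cprod HC).
Local Notation idl := (cprod_ran HC).
Local Notation idr := (cprod_dom HC).

Lemma ginvP x : inverse_of x (ginv x).
Proof. by apply: choice_orP; exact: (proj2 (og_groupoid HG)). Qed.

Lemma dom_ginv x : dom (ginv x) = ran x.
Proof. by have /(inverse_ofE HC)[] := ginvP x. Qed.

Lemma ran_ginv x : ran (ginv x) = dom x.
Proof. by have /(inverse_ofE HC)[] := ginvP x. Qed.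

Lemma cprodV x : x ** ginv x = ran x.
Proof. by have /(inverse_ofE HC)[] := ginvP x. Qed.

Lemma cprodVx x : ginv x ** x = dom x.
Proof. by have /(inverse_ofE HC)[] := ginvP x. Qed.

Lemma cprodKV x y : dom x = ran y -> ginv x ** (x ** y) = y.
Proof. by move=> xy; rewrite -cprodA ?dom_ginv // cprodVx xy idl. Qed.

Lemma cprodVK x y : ran x = ran y -> x ** (ginv x ** y) = y.
Proof. by move=> xy; rewrite -cprodA ?dom_ginv ?ran_ginv // cprodV xy idl. Qed.

Lemma cprod_ratio x y z : dom x = dom y -> dom y = dom z ->
  (x ** ginv y) ** (y ** ginv z) = x ** ginv z.
Proof.
move=> xy yz; rewrite cprodA ?cprodKV ?ran_cprod ?ran_ginv ?dom_ginv //.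
Qed.

Lemma ratio_cprod x y z : dom x = ran z -> dom y = ran z ->
  (x ** z) ** ginv (y ** z) = x ** ginv y.
Proof.
move=> xz yz; have Ez : dom z = ran (ginv (y ** z)) by rewrite ran_ginv dom_cprod.
rewrite cprodA //; congr (x ** _); rewrite -{1}(cprodKV yz).
rewrite cprodA ?dom_ginv ?ran_cprod ?ran_ginv // cprodV ran_cprod //.
by rewrite -dom_ginv idr.
Qed.

Lemma inverse_ratio x y : dom x = dom y ->
  inverse_of (x ** ginv y) (y ** ginv x).
Proof.
move=> xy; apply/(inverse_ofE HC).
have Ex : dom x = ran (ginv y) by rewrite ran_ginv.
have Ey : dom y = ran (ginv x) by rewrite ran_ginv.
by rewrite !cprod_ratio // !cprodV !dom_cprod // !ran_cprod // !dom_ginv.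
Qed.

Lemma ole_ginv x y : ole x y -> ole (ginv x) (ginv y).
Proof. by move=> xy; apply: (ole_inv HG) xy (ginvP x) (ginvP y). Qed.

Lemma ole_cprod x y u v : dom x = ran u -> dom y = ran v ->
  ole x y -> ole u v -> ole (x ** u) (y ** v).
Proof.
by move=> xu yv xy uv; apply: (ole_cmul HG) xy uv _ _; exact: (cmul_cprod HC).
Qed.

(** Monotonicity of domains is not an axiom; it follows from [dom x] being the product of the
    inverse of [x] with [x]. *)
Lemma ole_dom x y : ole x y -> ole (dom x) (dom y).
Proof.
move=> xy; rewrite -!cprodVx; apply: ole_cprod; rewrite ?dom_ginv //.
exact: ole_ginv.
Qed.

Lemma ole_ran x y : ole x y -> ole (ran x) (ran y).
Proof.
move=> xy; rewrite -!cprodV; apply: ole_cprod; rewrite ?ran_ginv //.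
exact: ole_ginv.
Qed.

Lemma restriction_uniq x y z :
  ole y x -> ole z x -> dom y = dom z -> y = z.
Proof.
move=> yx zx yz.
have [w [_ Hw]] := og_restriction HG (dom_identity HC y) (ole_dom yx).
by rewrite -(Hw y) // -(Hw z).
Qed.

Lemma corestriction_uniq x y z :
  ole y x -> ole z x -> ran y = ran z -> y = z.
Proof.
move=> yx zx yz.
have [w [_ Hw]] := og_corestriction HG (ran_identity HC y) (ole_ran yx).
by rewrite -(Hw y) // -(Hw z).
Qed.

Lemma resP x e : identity e -> ole e (dom x) -> is_restriction x e (res x e).
Proof.
move=> He ex; have [w [Hw _]] := og_restriction HG He ex.
by apply: choice_orP; exists w.
Qed.

Lemma coresP x e : identity e -> ole e (ran x) ->
  is_corestriction e x (cores e x).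
Proof.
move=> He ex; have [w [Hw _]] := og_corestriction HG He ex.
by apply: choice_orP; exists w.
Qed.

Lemma res_eq x y : ole y x -> res x (dom y) = y.
Proof.
move=> yx; have [] := resP (dom_identity HC y) (ole_dom yx).
by move=> H E; apply: restriction_uniq H yx E.
Qed.

Lemma is_meet_uniq e f m n : is_meet e f m -> is_meet e f n -> m = n.
Proof.
by move=> [im me mf mM] [jn ne nf nM]; apply: (ole_anti HG); auto.
Qed.

Lemma pseudoproduct_fun x y z z' :
  pseudoproduct x y z -> pseudoproduct x y z' -> z = z'.
Proof.
move=> [e [a [b [me [ax ae] [yb be] abz]]]] [f [c [d [mf [cx cf] [dy df] cdz]]]].
have ef := is_meet_uniq me mf; subst f.
have ac : a = c by apply: restriction_uniq ax cx _; congruence.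
have bd : b = d by apply: corestriction_uniq yb dy _; congruence.
by subst c d; apply: (cmul_fun HC) abz cdz.
Qed.

Section Otimes.
Variables (x y : G) (yx : ole (ran y) (dom x)).

Lemma otimes_res : is_restriction x (ran y) (res x (ran y)).
Proof. by apply: resP yx; exact: (ran_identity HC). Qed.

Lemma dom_res : dom (res x (ran y)) = ran y. Proof. by case: otimes_res. Qed.

Lemma res_le : ole (res x (ran y)) x. Proof. by case: otimes_res. Qed.

Lemma dom_otimes : dom (otimes x y) = dom y.
Proof. by rewrite dom_cprod ?dom_res. Qed.

Lemma ran_otimes : ran (otimes x y) = ran (res x (ran y)).
Proof. by rewrite ran_cprod ?dom_res. Qed.

Lemma ran_otimes_le : ole (ran (otimes x y)) (ran x).
Proof. by rewrite ran_otimes; apply: ole_ran; exact: res_le. Qed.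

(** Since [ran y <= dom x], the meet in the definition is [ran y]; only [x] is truly restricted, and
    [y] is its own corestriction. *)
Lemma pseudoproductE z : pseudoproduct x y z <-> otimes x y = z.
Proof.
have xy : pseudoproduct x y (otimes x y).
  exists (ran y), (res x (ran y)), y; split.
  - split=> //; [exact: (ran_identity HC)|exact: (ole_refl HG)].
  - exact: otimes_res.
  - by split=> //; exact: (ole_refl HG).
  - by apply: (cmul_cprod HC); rewrite dom_res.
by split=> [|<-//]; exact: pseudoproduct_fun.
Qed.

End Otimes.

Lemma otimes_cprod x y : dom x = ran y -> otimes x y = x ** y.
Proof.
by move=> xy; rewrite /otimes -xy res_eq //; exact: (ole_refl HG).
Qed.

(** After [z] is split off on the right, both remaining factors lie below [otimes x y] and have
    domain [ran z], so uniqueness of restrictions identifies them. The comparison uses that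
    restricting [x] in two stages agrees with restricting it at once. *)
Lemma otimesA x y z : ole (ran y) (dom x) -> ole (ran z) (dom y) ->
  otimes (otimes x y) z = otimes x (otimes y z).
Proof.
move=> yx zy; have yzx : ole (ran (otimes y z)) (dom x).
  by apply: (ole_trans HG) yx; exact: ran_otimes_le.
have zxy : ole (ran z) (dom (otimes x y)) by rewrite dom_otimes.
have E : dom (res x (ran (otimes y z))) = ran (res y (ran z)).
  by rewrite dom_res // ran_otimes.
change (res (otimes x y) (ran z) ** z =
  res x (ran (otimes y z)) ** (res y (ran z) ** z)).
rewrite -cprodA ?E ?dom_res //; congr (_ ** z).
apply: (@restriction_uniq (otimes x y)); first exact: res_le.
  apply: (ole_cprod E); rewrite ?dom_res //; last exact: res_le.
  have yzxy : ole (ran (otimes y z)) (dom (res x (ran y))).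
    by rewrite dom_res //; exact: ran_otimes_le.
  suff <- : res (res x (ran y)) (ran (otimes y z)) = res x (ran (otimes y z)).
    exact: res_le.
  apply: (@restriction_uniq x); last (by rewrite dom_res // dom_res);
    last exact: res_le.
  by apply: (ole_trans HG) (res_le yx); exact: res_le.
by rewrite dom_res // dom_cprod // dom_res.
Qed.

(** The range of [otimes x y] determines, by uniqueness of corestrictions, which restriction of [x]
    was used; what remains is cancellation in the groupoid. This gives left cancellation in
    [L(G)]. *)
Lemma otimesI x y z : ole (ran y) (dom x) -> ole (ran z) (dom x) ->
  otimes x y = otimes x z -> y = z.
Proof.
move=> yx zx E; have yz : res x (ran y) = res x (ran z).
  apply: corestriction_uniq (res_le yx) (res_le zx) _.
  by rewrite -!ran_otimes // E.
have ryz : ran y = ran z by rewrite -(dom_res yx) yz dom_res.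
by rewrite -(cprodKV (dom_res yx)) -(cprodKV (dom_res zx)) -/(otimes x y) E yz.
Qed.

(** A common right factor [t] cancels from the quotient and leaves restrictions of [a] and [b].
    Conversely [t] is forced by [x]: with [a'] the corestriction of [a] to [ran x], it is the
    inverse of [a'] times [x]. That the same [t] carries [b] to [y] holds because two elements below
    [b ** ginv a] with domain [ran x] coincide. *)
Lemma ole_ratio a b x y : dom a = dom b -> dom x = dom y ->
  (exists t, [/\ ole (ran t) (dom a), otimes a t = x & otimes b t = y]) <->
  ole (x ** ginv y) (a ** ginv b).
Proof.
move=> ab xy; have Exy : dom x = ran (ginv y) by rewrite ran_ginv.
have Eyx : dom y = ran (ginv x) by rewrite ran_ginv.
have Eab : dom a = ran (ginv b) by rewrite ran_ginv.
have Eba : dom b = ran (ginv a) by rewrite ran_ginv.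
split=> [[t [ta <- <-]]|le].
  have tb : ole (ran t) (dom b) by rewrite -ab.
  set a' := res a (ran t); set b' := res b (ran t).
  have Ea : dom a' = ran t := dom_res ta.
  have Eb : dom b' = ran t := dom_res tb.
  suff -> : otimes a t ** ginv (otimes b t) = a' ** ginv b'.
    apply: ole_cprod; rewrite ?ran_ginv ?Ea //; first exact: res_le.
    by apply: ole_ginv; exact: res_le.
  exact: ratio_cprod.
have xa : ole (ran x) (ran a).
  by have := ole_ran le; rewrite !ran_cprod.
have [] := coresP (ran_identity HC x) xa.
set a' := cores (ran x) a => a'a Ea'.
have Et : dom (ginv a') = ran x by rewrite dom_ginv.
exists (ginv a' ** x); have rt : ran (ginv a' ** x) = dom a'.
  by rewrite ran_cprod // ran_ginv.
have ta : ole (dom a') (dom a) := ole_dom a'a.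
have tb : ole (dom a') (dom b) by rewrite -ab.
have Rb := resP (dom_identity HC a') tb; have [b'b Eb'] := Rb.
rewrite rt /otimes rt; split=> //; first by rewrite res_eq // cprodVK.
have Eb : dom (res b (dom a')) = ran (ginv a') by rewrite Eb' ran_ginv.
rewrite -cprodA //.
suff -> : res b (dom a') ** ginv a' = y ** ginv x.
  by rewrite cprodA ?dom_ginv // cprodVx xy idr.
apply: (@restriction_uniq (b ** ginv a)).
- by apply: ole_cprod => //; exact: ole_ginv.
- by apply: (ole_inv HG) le _ _; exact: inverse_ratio.
- by rewrite !dom_cprod // !dom_ginv.
Qed.

End OrderedGroupoid.

(** * The ordered groupoid of a left rooted category *)

Section LeftRooted.
Variables (C : arrows) (one : C) (HC1 : left_rooted one).
Let HC : category C. Proof. by case: HC1. Qed.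
Let HL : left_cancellative C. Proof. by case: HC1. Qed.
Let H1 : identity one. Proof. by case: HC1 => _ _ []. Qed.
Implicit Types (p q : Upair one) (X Y Z E : Gl one) (a b c d t u e : C).

Local Notation cmulE := (cmulE HC).
Local Notation cprodA := (cprodA HC).
Local Notation dom_cprod := (dom_cprod HC).
Local Notation ran_cprod := (ran_cprod HC).
Local Notation idl := (cprod_ran HC).
Local Notation idr := (cprod_dom HC).
Local Notation cprodI := (cprodI HC HL).

Lemma UsimE p q : Usim p q <->
  exists u, [/\ isomorphism u, dom (Ufst q) = ran u,
    Ufst q ** u = Ufst p & Usnd q ** u = Usnd p].
Proof.
split=> [[u [iu /cmulE[qu E] /cmulE[_ E']]]|[u [iu qu E E']]]; exists u => //.
by split=> //; apply/cmulE; rewrite -?(Udom q).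
Qed.

Lemma Usim_refl p : Usim p p.
Proof.
apply/UsimE; exists (dom (Ufst p)); split; rewrite ?idr ?(ran_dom HC) //.
  by apply: (identity_isomorphism HC); exact: (dom_identity HC).
by rewrite Udom idr.
Qed.

Lemma Usim_sym p q : Usim p q -> Usim q p.
Proof.
move=> /UsimE[u [[v uv] qu E E']]; apply/UsimE; exists v.
have [duv dvu Euv Evu] := proj1 (inverse_ofE HC u v) uv.
split; first by exists u; exact: (inverse_of_sym HC).
- by rewrite -E dom_cprod.
- by rewrite -E cprodA // Euv -qu idr.
- by rewrite -E' cprodA -?Udom // Euv -qu Udom idr.
Qed.

Lemma Usim_trans p q s : Usim p q -> Usim q s -> Usim p s.
Proof.
move=> /UsimE[u [iu qu E E']] /UsimE[v [iv sv F F']].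
have vu : dom v = ran u by rewrite -qu -F dom_cprod.
apply/UsimE; exists (v ** u); split.
- exact: (isomorphism_cprod HC).
- by rewrite ran_cprod.
- by rewrite -cprodA // F E.
- by rewrite -cprodA -?Udom // F' E'.
Qed.

Lemma gclass_eq p q : gclass p = gclass q <-> Usim p q.
Proof.
split=> [[E]|pq].
  have : [set r | Usim r p]%classic p by exact: Usim_refl.
  by rewrite E.
apply: eq_exist; apply/seteqP; split=> r /= rp.
  exact: Usim_trans rp pq.
by apply: Usim_trans rp _; exact: Usim_sym.
Qed.

Lemma class_reprK X : gclass (class_repr X) = X.
Proof.
case: X => A HA; apply: eq_exist.
by rewrite /class_repr /=; case: cid => p /= ->.
Qed.

(* [represents X a b] is [X = [a, b]] in the notation of the paper. *)
Definition represents X a b : Prop :=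
  exists p, [/\ X = gclass p, Ufst p = a & Usnd p = b].

Lemma represents_exists X : exists a b, represents X a b.
Proof.
exists (Ufst (class_repr X)), (Usnd (class_repr X)), (class_repr X).
by rewrite class_reprK.
Qed.

Lemma representsU X a b : represents X a b ->
  [/\ dom a = dom b, ran a = one & ran b = one].
Proof. by move=> [p [_ <- <-]]; rewrite Udom Uran1 Uran2. Qed.

Lemma represents_mk a b : dom a = dom b -> ran a = one -> ran b = one ->
  exists X, represents X a b.
Proof. by move=> ab a1 b1; exists (gclass (UPair ab a1 b1)); eexists. Qed.

Lemma upair_eq p q : Ufst p = Ufst q -> Usnd p = Usnd q -> p = q.
Proof.
by case: p q => a b ab a1 b1 [c d cd c1 d1] /= E F; subst c d; f_equal.
Qed.

Lemma represents_class p : represents (gclass p) (Ufst p) (Usnd p).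
Proof. by exists p. Qed.

Lemma represents_inj X Y a b : represents X a b -> represents Y a b -> X = Y.
Proof.
move=> [p [-> pa pb]] [q [-> qa qb]]; congr gclass.
by apply: upair_eq; congruence.
Qed.

Lemma represents_iso X a b u : represents X a b -> isomorphism u ->
  dom a = ran u -> represents X (a ** u) (b ** u).
Proof.
move=> Xab iu au; have [ab a1 b1] := representsU Xab.
have bu : dom b = ran u by rewrite -ab.
have [|||Y Yab] := @represents_mk (a ** u) (b ** u).
- by rewrite !dom_cprod.
- by rewrite ran_cprod.
- by rewrite ran_cprod.
suff -> : X = Y by [].
move: Xab Yab => [p [-> pa pb]] [q [-> qa qb]]; apply/esym/gclass_eq/UsimE.
by exists u; rewrite pa pb qa qb.
Qed.

Lemma represents_uniq X a b c d : represents X a b -> represents X c d ->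
  exists u, [/\ isomorphism u, dom a = ran u, c = a ** u & d = b ** u].
Proof.
move=> [p [-> <- <-]] [q [pq <- <-]].
have /esym/gclass_eq/UsimE[u [iu pu E F]] := pq.
by exists u.
Qed.

(** The isomorphism between the two pairs fixes [b] on the right, so left cancellation makes it an
    identity. Fixing the second entry thus removes the ambiguity of representatives. *)
Lemma represents_snd X a a' b : represents X a b -> represents X a' b -> a = a'.
Proof.
move=> Xab Xa'b; have [u [_ au -> E]] := represents_uniq Xab Xa'b.
have [ab _ _] := representsU Xab.
suff -> : u = dom a by rewrite idr.
have bu : dom b = ran u by rewrite -ab.
by apply: (cprodI bu); rewrite ab ?(ran_dom HC) // idr.
Qed.

Lemma represents_dom X a b : represents X a b -> represents (dom X) b b.
Proof.
move=> Xab; have [u [iu au E F]] := represents_uniq (ex_intro _ _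
  (And3 (esym (class_reprK X)) erefl erefl)) Xab.
have D := represents_class (Udiag2 (class_repr X)).
by rewrite F; apply: represents_iso D iu _; rewrite -Udom.
Qed.

Lemma represents_ran X a b : represents X a b -> represents (ran X) a a.
Proof.
move=> Xab; have [u [iu au E F]] := represents_uniq (ex_intro _ _
  (And3 (esym (class_reprK X)) erefl erefl)) Xab.
have D := represents_class (Udiag1 (class_repr X)).
by rewrite E; apply: represents_iso D iu _.
Qed.

(** Changing representatives replaces the factor [t] by [v ** (t ** u)] with isomorphisms [u] and
    [v], so the order can be tested on any two pairs. *)
Lemma represents_le X Y a b c d : represents X a b -> represents Y c d ->
  ole X Y <-> exists t, [/\ dom c = ran t, c ** t = a & d ** t = b].
Proof.
move=> Xab Ycd; have [ab _ _] := representsU Xab.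
have [cd _ _] := representsU Ycd; split; last first.
  move=> [t [ct E F]]; have [[p [-> Ep Fp]] [q [-> Eq Fq]]] := (Xab, Ycd).
  by exists p, q, t; rewrite Ep Fp Eq Fq; split=> //; apply/cmulE; rewrite -?cd.
move=> [p [q [t [EX EY /cmulE[qt E] /cmulE[_ F]]]]].
have Xp : represents X (Ufst p) (Usnd p) by exists p.
have Yq : represents Y (Ufst q) (Usnd q) by exists q.
have [u [iu pu -> ->]] := represents_uniq Xp Xab.
have [v [iv cv Ev Fv]] := represents_uniq Ycd Yq.
have vt : dom v = ran t by rewrite -qt Ev dom_cprod.
have tu : dom t = ran u by rewrite -pu -E dom_cprod.
exists (v ** (t ** u)); split.
- by rewrite ran_cprod // ran_cprod.
- by rewrite -cprodA ?ran_cprod // -Ev -cprodA // E.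
- by rewrite -cprodA -?cd ?ran_cprod // -Fv -cprodA -?Udom // F.
Qed.

Lemma represents_match X Y : dom X = ran Y ->
  exists a b c, represents X a b /\ represents Y b c.
Proof.
move=> XY; have [a [b Xab]] := represents_exists X.
have [c [d Ycd]] := represents_exists Y.
have := represents_dom Xab; rewrite XY => Yb.
have [u [iu cu Eb _]] := represents_uniq (represents_ran Ycd) Yb.
exists a, b, (d ** u); split=> //; rewrite {1}Eb.
exact: represents_iso.
Qed.

(** The isomorphism in the definition of the product is absorbed into the second pair, after which
    the middle entries agree and classes compose like fractions. In the other direction the
    isomorphism is taken to be [dom b]. *)
Lemma Gl_cmulE X Y Z : cmul X Y Z <-> exists a b c,
  [/\ represents X a b, represents Y b c & represents Z a c].
Proof.
split=> [[p [q [s [u [[-> -> ->] [iu /cmulE[qu Eu] Es /cmulE[_ Fu]]]]]]]|].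
  exists (Ufst p), (Usnd p), (Usnd s); split; [by exists p| |by exists s].
  by rewrite -Eu -Fu; apply: represents_iso => //; exact: represents_class.
move=> [a [b [c [[p [-> Ep Fp]] [q [-> Eq Fq]] [s [-> Es Fs]]]]]].
exists p, q, s, (dom b); split=> //; split.
- by apply: (identity_isomorphism HC); exact: (dom_identity HC).
- by rewrite Eq Fp; exact: (cmul_dom HC).
- by rewrite Ep.
- by rewrite Fq Fs -Eq Udom Fq; exact: (cmul_dom HC).
Qed.

(** The factors [t] and [u] of the two inequalities both carry [b'] to [b], so left cancellation
    makes them equal, and the common factor serves the outer entries. *)
Lemma represents_le_cprod X Y Z X' Y' Z' a b c a' b' c' :
  represents X a b -> represents Y b c -> represents Z a c ->
  represents X' a' b' -> represents Y' b' c' -> represents Z' a' c' ->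
  ole X X' -> ole Y Y' -> ole Z Z'.
Proof.
move=> Xab Ybc Zac Xab' Ybc' Zac' /(represents_le Xab Xab')[t [at' Ea Eb]].
move=> /(represents_le Ybc Ybc')[u [bu Eb' Ec]].
have [ab' _ _] := representsU Xab'.
have bt : dom b' = ran t by rewrite -ab'.
have tu : t = u by apply: (cprodI bt bu); rewrite Eb Eb'.
by apply/(represents_le Zac Zac'); exists t; split=> //; rewrite tu.
Qed.

Lemma Gl_le_refl X : ole X X.
Proof.
have [a [b Xab]] := represents_exists X; apply/(represents_le Xab Xab).
have [ab _ _] := representsU Xab.
by exists (dom a); rewrite (ran_dom HC) idr ab idr.
Qed.

Lemma Gl_le_trans X Y Z : ole X Y -> ole Y Z -> ole X Z.
Proof.
have [[a [b Xab]] [c [d Ycd]]] := (represents_exists X, represents_exists Y).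
have [e [f Zef]] := represents_exists Z; have [ef _ _] := representsU Zef.
move=> /(represents_le Xab Ycd)[t [ct Ea Eb]].
move=> /(represents_le Ycd Zef)[u [eu Ec Ed]]; apply/(represents_le Xab Zef).
have ut : dom u = ran t by rewrite -ct -Ec dom_cprod.
exists (u ** t); split; first by rewrite ran_cprod.
  by rewrite -cprodA // Ec.
by rewrite -cprodA // -?ef // Ed.
Qed.

(** The two factors compose to arrows that fix [c] and [a] on the right; left cancellation turns
    these into identities, so the factors are mutually inverse isomorphisms. *)
Lemma Gl_le_anti X Y : ole X Y -> ole Y X -> X = Y.
Proof.
have [[a [b Xab]] [c [d Ycd]]] := (represents_exists X, represents_exists Y).
move=> /(represents_le Xab Ycd)[t [ct Ea Eb]].
move=> /(represents_le Ycd Xab)[u [au Ec Ed]].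
have tu : dom t = ran u by rewrite -au -Ea dom_cprod.
have ut : dom u = ran t by rewrite -ct -Ec dom_cprod.
have it : isomorphism t.
  exists u; apply/(inverse_ofE HC); split=> //.
    have ctu : dom c = ran (t ** u) by rewrite ran_cprod.
    by apply: (cprodI ctu); rewrite ?(ran_ran HC) // -cprodA // Ea Ec -ct idr.
  have aut : dom a = ran (u ** t) by rewrite ran_cprod.
  apply: (cprodI aut); rewrite ?(ran_dom HC) ?tu //.
  by rewrite -cprodA // Ec Ea -au idr.
by apply: represents_inj Xab _; rewrite -Ea -Eb; exact: represents_iso.
Qed.

Lemma represents_identity X a : represents X a a -> identity X.
Proof.
move=> Xaa; split=> Y Z /Gl_cmulE[b [c [d [H K L]]]];
  have [u [_ _ Eb Ec]] := represents_uniq Xaa ltac:(eassumption).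
  by apply: represents_inj L _; rewrite Eb -Ec.
by apply: represents_inj L _; rewrite Ec -Eb.
Qed.

(** Independence of representatives is monotonicity of the product applied to reflexive inequalities
    in both directions, followed by antisymmetry. *)
Lemma Gl_cmul_fun X Y Z Z' : cmul X Y Z -> cmul X Y Z' -> Z = Z'.
Proof.
move=> /Gl_cmulE[a [b [c [Xab Ybc Zac]]]].
move=> /Gl_cmulE[a' [b' [c' [Xab' Ybc' Zac']]]].
by apply: Gl_le_anti;
  [apply: (represents_le_cprod Xab Ybc Zac Xab' Ybc' Zac') |
   apply: (represents_le_cprod Xab' Ybc' Zac' Xab Ybc Zac)]; exact: Gl_le_refl.
Qed.

Lemma Gl_cmul X Y a b c : represents X a b -> represents Y b c ->
  exists2 Z, represents Z a c & cmul X Y Z.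
Proof.
move=> Xab Ybc; have [[ab a1 b1] [bc _ c1]] := (representsU Xab, representsU Ybc).
have [|||Z Zac] := @represents_mk a c; rewrite -?bc //.
by exists Z => //; apply/Gl_cmulE; exists a, b, c.
Qed.

Lemma Gl_category : category (Gl one).
Proof.
split.
- exact: Gl_cmul_fun.
- move=> X Y; split=> [[Z /Gl_cmulE[a [b [c [Xab Ybc Zac]]]]]|XY].
    exact: represents_inj (represents_dom Xab) (represents_ran Ybc).
  have [a [b [c [Xab Ybc]]]] := represents_match XY.
  by have [Z _ ?] := Gl_cmul Xab Ybc; exists Z.
- move=> X; have [a [b Xab]] := represents_exists X.
  exact: represents_identity (represents_dom Xab).
- move=> X; have [a [b Xab]] := represents_exists X.
  exact: represents_identity (represents_ran Xab).
- move=> X; have [a [b Xab]] := represents_exists X.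
  by apply/Gl_cmulE; exists a, b, b; split=> //; exact: represents_dom Xab.
- move=> X; have [a [b Xab]] := represents_exists X.
  by apply/Gl_cmulE; exists a, a, b; split=> //; exact: represents_ran Xab.
- move=> X Y Z /Gl_cmulE[a [b [c [_ Ybc Zac]]]].
  exact: represents_inj (represents_dom Zac) (represents_dom Ybc).
- move=> X Y Z /Gl_cmulE[a [b [c [Xab _ Zac]]]].
  exact: represents_inj (represents_ran Zac) (represents_ran Xab).
move=> X Y Z XY YZ W XYm YZm.
have /Gl_cmulE[a [b [c [Xab Ybc XYac]]]] := XYm.
have /Gl_cmulE[b' [c' [d' [Ybc' Zcd' _]]]] := YZm.
have [u [iu bu Eb Ec]] := represents_uniq Ybc' Ybc.
have [_ _ cc] := representsU Ybc'.
have [bc' _ _] := representsU Ybc'.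
(* Realigning the third pair along [u] gives a single chain [a], [b], [c], [d] that serves both
   bracketings. *)
have Zcd : represents Z c (d' ** u).
  by rewrite Ec; apply: represents_iso Zcd' iu _; rewrite -bc'.
set d := d' ** u in Zcd.
have [V Vbd Vm] := Gl_cmul Ybc Zcd; have ? := Gl_cmul_fun YZm Vm; subst V.
have [V Vad Vl] := Gl_cmul XYac Zcd; have [V' Vad' Vr] := Gl_cmul Xab Vbd.
have ? := represents_inj Vad Vad'; subst V'.
by split=> Wm; [rewrite (Gl_cmul_fun Wm Vl)|rewrite (Gl_cmul_fun Wm Vr)].
Qed.

Lemma represents_inverse X Y a b :
  represents X a b -> represents Y b a -> inverse_of X Y.
Proof.
move=> Xab Yba; split; apply/Gl_cmulE.
  by exists a, b, a; split=> //; exact: represents_ran Xab.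
by exists b, a, b; split=> //; exact: represents_dom Xab.
Qed.

Lemma represents_inv X Y a b :
  represents X a b -> inverse_of X Y -> represents Y b a.
Proof.
move=> Xab XY; have [ab a1 b1] := representsU Xab.
have [|||Z Zba] := @represents_mk b a => //.
by rewrite (inverse_of_uniq Gl_category XY (represents_inverse Xab Zba)).
Qed.

Lemma identity_represents X : identity X -> exists a, represents X a a.
Proof.
move=> iX; have [a [b Xab]] := represents_exists X; exists b.
by rewrite -(identity_dom Gl_category iX); exact: represents_dom Xab.
Qed.

Lemma Gl_ordered_groupoid : ordered_groupoid (Gl one).
Proof.
split.
- split=> [|X]; first exact: Gl_category.
  have [a [b Xab]] := represents_exists X; have [ab a1 b1] := representsU Xab.
  have [|||Y Yba] := @represents_mk b a => //.
  by exists Y; exact: represents_inverse Xab Yba.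
- exact: Gl_le_refl.
- exact: Gl_le_anti.
- exact: Gl_le_trans.
- move=> X Y X' Y'.
  have [[a [b Xab]] [c [d Ycd]]] := (represents_exists X, represents_exists Y).
  move=> /(represents_le Xab Ycd)[t [ct Ea Eb]].
  move=> /(represents_inv Xab) Xba /(represents_inv Ycd) Ydc.
  apply/(represents_le Xba Ydc); exists t; split=> //.
  by have [<-] := representsU Ycd.
- move=> X Y U V XU YV XY UV /Gl_cmulE[a [b [c [? ? ?]]]].
  by move=> /Gl_cmulE[a' [b' [c' [? ? ?]]]];
    apply: represents_le_cprod XY UV; eassumption.
(* If [e = b t], the restriction of [[a, b]] to [[e, e]] is [[a t, e]]. It is unique because left
   cancellation of [b] determines [t]. Corestriction is symmetric. *)
- move=> X E /identity_represents[e Ee] EX.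
  have [a [b Xab]] := represents_exists X; have [ab a1 b1] := representsU Xab.
  have /(represents_le Ee (represents_dom Xab))[t [bt Et _]] := EX.
  have at' : dom a = ran t by rewrite ab.
  have [|||Y Yat] := @represents_mk (a ** t) e;
    rewrite -?Et ?dom_cprod ?ran_cprod //.
  have YE := represents_inj (represents_dom Yat) Ee.
  have YX : ole Y X by apply/(represents_le Yat Xab); exists t.
  exists Y; split=> // Z [ZX ZE]; have [c [d Zcd]] := represents_exists Z.
  have := represents_dom Zcd; rewrite ZE => Ed.
  have [u [iu du Ee' _]] := represents_uniq Ed Ee.
  have [cd _ _] := representsU Zcd.
  have Zce : represents Z (c ** u) e.
    by rewrite Ee'; apply: represents_iso Zcd iu _; rewrite cd.
  have /(represents_le Zce Xab)[s [as' Ec Es]] := ZX.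
  have bs : dom b = ran s by rewrite -ab.
  have st : s = t by apply: (cprodI bs bt); rewrite Et.
  by apply: represents_inj Yat _; rewrite -st Ec.
- move=> X E /identity_represents[e Ee] EX.
  have [a [b Xab]] := represents_exists X; have [ab a1 b1] := representsU Xab.
  have /(represents_le Ee (represents_ran Xab))[t [at' Et _]] := EX.
  have bt : dom b = ran t by rewrite -ab.
  have [|||Y Yat] := @represents_mk e (b ** t);
    rewrite -?Et ?dom_cprod ?ran_cprod //.
  have YE := represents_inj (represents_ran Yat) Ee.
  have YX : ole Y X by apply/(represents_le Yat Xab); exists t.
  exists Y; split=> // Z [ZX ZE]; have [c [d Zcd]] := represents_exists Z.
  have := represents_ran Zcd; rewrite ZE => Ed.
  have [u [iu cu Ee' _]] := represents_uniq Ed Ee.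
  have Zce : represents Z e (d ** u).
    by rewrite Ee'; apply: represents_iso Zcd iu _.
  have /(represents_le Zce Xab)[s [as' Es Ec]] := ZX.
  have st : s = t by apply: (cprodI as' at'); rewrite Et.
  by apply: represents_inj Yat _; rewrite -st Ec.
Qed.

(** Every arrow [a] into [one] factors as [one ** a], which is divisibility of [(a, a)] by
    [(one, one)]. *)
Lemma represents_maximum M : represents M one one ->
  maximum_identity (G := Gl one) M.
Proof.
move=> M1; split=> [|X /identity_represents[a Xaa]].
  exact: represents_identity M1.
have [_ a1 _] := representsU Xaa.
apply/(represents_le Xaa M1); exists a.
by rewrite (identity_dom HC H1) -a1 idl.
Qed.

Lemma represents_maximum_exists : exists M, represents M one one.
Proof. by apply: represents_mk; rewrite // (identity_ran HC H1). Qed.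

End LeftRooted.

(** * The left category of an ordered groupoid *)

Section LeftCategoryTheory.
Variables (G : ordered_arrows) (HG : ordered_groupoid G).
Let HC : category G := proj1 (og_groupoid HG).
Implicit Types (a b c d : Lcat HG) (e f m x y z : G).

Lemma Lpair_eq a b : Lid a = Lid b -> Larr a = Larr b -> a = b.
Proof. by case: a b => e x ie xe [f y jf yf] /= E F; subst f y; f_equal. Qed.

Lemma Lcat_dom_ran a b : dom a = ran b <-> dom (Larr a) = Lid b.
Proof. by split=> [[]//|E]; apply: Lpair_eq. Qed.

(** The bound on ranges built into the pairs puts every matching pair in the case where [otimes]
    computes the pseudoproduct. *)
Lemma Lcat_cmulE a b c : cmul a b c <->
  [/\ dom (Larr a) = Lid b, Lid c = Lid a & otimes (Larr a) (Larr b) = Larr c].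
Proof.
have H : dom (Larr a) = Lid b -> ole (ran (Larr b)) (dom (Larr a)).
  by move=> ->; exact: Lran_le.
by split=> [[E F /(pseudoproductE HG (H E))]//|[E F P]]; split=> //;
  apply/(pseudoproductE HG (H E)).
Qed.

Lemma Lcat_ran_le a b : dom (Larr a) = Lid b ->
  ole (ran (Larr b)) (dom (Larr a)).
Proof. by move=> ->; exact: Lran_le. Qed.

Lemma Lcat_cmul a b : dom (Larr a) = Lid b -> exists c, cmul a b c.
Proof.
move=> ab; have le : ole (ran (otimes (Larr a) (Larr b))) (Lid a).
  apply: (ole_trans HG) (Lran_le a).
  by apply: (ran_otimes_le HG); exact: Lcat_ran_le.
by exists (LPair (Lid_identity a) le); apply/Lcat_cmulE.
Qed.

Lemma Ldiag_identity e (He : identity e) : identity (Ldiag HG He : Lcat HG).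
Proof.
split=> a b /Lcat_cmulE[/= E F P]; apply: Lpair_eq => //.
- by rewrite F -E (identity_dom HC He).
- have le : ole (ran (Larr a)) e.
    by rewrite -[e](identity_dom HC He) E; exact: Lran_le.
  by rewrite -P /otimes -{1}(dom_ran HC) (res_eq HG le) (cprod_ran HC).
- by rewrite -P (otimes_cprod HG) ?(identity_ran HC He) // -E (cprod_dom HC).
Qed.

Lemma Lcat_category : category (Lcat HG).
Proof.
split.
- move=> a b c c' /Lcat_cmulE[_ E F] /Lcat_cmulE[_ E' F'].
  by apply: Lpair_eq; congruence.
- move=> a b; rewrite Lcat_dom_ran; split=> [[c /Lcat_cmulE[]]//|].
  exact: Lcat_cmul.
- by move=> a; exact: Ldiag_identity.
- by move=> a; exact: Ldiag_identity.
- move=> a; apply/Lcat_cmulE; split=> //=.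
  by rewrite (otimes_cprod HG) ?(ran_dom HC) // (cprod_dom HC).
- move=> a; apply/Lcat_cmulE; split=> //=.
    exact: (identity_dom HC (Lid_identity a)).
  have le := Lran_le a; rewrite /otimes -{1}(dom_ran HC) (res_eq HG le).
  exact: (cprod_ran HC).
- move=> a b c /Lcat_cmulE[E F P]; apply: Lpair_eq => /=;
    by rewrite -P (dom_otimes HG) //; exact: Lcat_ran_le.
- by move=> a b c /Lcat_cmulE[E F P]; apply: Lpair_eq => /=.
move=> a b c ab bc w /Lcat_cmulE[Eab Fab Pab] /Lcat_cmulE[Ebc Fbc Pbc].
have A := otimesA HG (Lcat_ran_le Eab) (Lcat_ran_le Ebc).
have Dab : dom (Larr ab) = dom (Larr b).
  by rewrite -Pab (dom_otimes HG) //; exact: Lcat_ran_le.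
split=> /Lcat_cmulE[E F P]; apply/Lcat_cmulE; split.
- by rewrite Fbc.
- by rewrite F.
- by rewrite -Pbc -A Pab.
- by rewrite Dab.
- by rewrite F.
- by rewrite -Pab A Pbc.
Qed.

Lemma Lcat_left_cancellative : left_cancellative (Lcat HG).
Proof.
move=> a b c d /Lcat_cmulE[E _ P] /Lcat_cmulE[E' _ P'].
apply: Lpair_eq; first by rewrite -E.
by apply: (otimesI HG (Lcat_ran_le E) (Lcat_ran_le E')); rewrite P.
Qed.

Lemma identity_LcatE a : identity a -> Larr a = Lid a.
Proof. by move=> /(identity_ran Lcat_category) <-. Qed.

Lemma Lcat_left_rooted one (H1 : identity one) :
  maximum_identity one -> left_rooted (Ldiag HG H1 : Lcat HG).
Proof.
move=> [_ max1]; split.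
- exact: Lcat_category.
- exact: Lcat_left_cancellative.
split=> [|a ia]; first exact: Ldiag_identity.
have le : ole (ran (Lid a)) one.
  by rewrite (identity_ran HC (Lid_identity a)); exact: max1 (Lid_identity a).
(* The arrow from [(e, e)] to [(1, 1)] is [(1, e)]; it belongs to [L(G)] because [1] is the
   maximum. *)
exists (LPair H1 le); split; last exact: Lpair_eq.
by apply: Lpair_eq => /=; rewrite ?(identity_LcatE ia)
  (identity_dom HC (Lid_identity a)).
Qed.

(** The diagonal of a commuting square supplies a common lower bound of two ranges, which is how
    allowable squares meet the hypothesis of being star-inductive. *)
Lemma Lcat_square_ran a b c d w : cmul a c w -> cmul b d w ->
  [/\ identity (ran (Larr w)), ole (ran (Larr w)) (ran (Larr a)) &
      ole (ran (Larr w)) (ran (Larr b))].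
Proof.
move=> /Lcat_cmulE[E _ P] /Lcat_cmulE[E' _ P']; split.
- exact: (ran_identity HC).
- by rewrite -P; apply: (ran_otimes_le HG); exact: Lcat_ran_le.
- by rewrite -P'; apply: (ran_otimes_le HG); exact: Lcat_ran_le.
Qed.

Lemma otimes_ginv_cores x m : identity m -> ole m (ran x) ->
  ole (ran (ginv (cores m x))) (dom x) /\ otimes x (ginv (cores m x)) = m.
Proof.
move=> im mx; have [le E] := coresP HG im mx.
rewrite (ran_ginv HG); split; first exact: (ole_dom HG).
rewrite /otimes (ran_ginv HG) (res_eq HG le).
by rewrite (cprodV HG).
Qed.

(* [(dom x, (m|x)^-1)] and [(dom y, (m|y)^-1)] complete [(e, x)] and [(e, y)]
   to a square with diagonal [(e, m)]. *)
Lemma Lcat_pullback a b m : ran a = ran b ->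
  is_meet (ran (Larr a)) (ran (Larr b)) m -> exists p q, is_pullback a b p q.
Proof.
move=> ab [im ma mb mM].
have Eab : Lid a = Lid b by case: ab.
have side (c : Lcat HG) : ole m (ran (Larr c)) -> Lid c = Lid a ->
    exists p : Lcat HG,
    [/\ Lid p = dom (Larr c), dom (Larr p) = m &
        forall w : Lcat HG, Lid w = Lid a -> Larr w = m -> cmul c p w].
  move=> mc Ec; have [le E] := otimes_ginv_cores im mc.
  have [_ Ed] := coresP HG im mc.
  exists (LPair (dom_identity HC (Larr c)) le : Lcat HG); split=> //=.
    by rewrite (dom_ginv HG).
  by move=> w Ew Fw; split; rewrite ?Ew ?Fw //; apply/(pseudoproductE HG le).
have [p [Ep Dp Hp]] := side a ma erefl.
have [q [Eq Dq Hq]] := side b mb (esym Eab).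
have lem : ole (ran m) (Lid a).
  rewrite (identity_ran HC im); exact: (ole_trans HG) ma (Lran_le a).
pose w0 : Lcat HG := LPair (Lid_identity a) lem.
have apw : cmul a p w0 by exact: Hp.
have bqw : cmul b q w0 by exact: Hq.
exists p, q; split; first by exists w0.
move=> p' q' [w [ap' bq']].
have [iw wa wb] := Lcat_square_ran ap' bq'.
have wm := mM _ iw wa wb.
(* The mediating arrow is [(m, w)]: the diagonal [(e, m)] followed by it gives back [w], and
   cancelling [a] and [b] on the left yields the two required factorizations. *)
pose u : Lcat HG := LPair im wm.
have [r pu] := @Lcat_cmul p u Dp.
have [s qu] := @Lcat_cmul q u Dq.
have w0u : cmul w0 u w.
  apply/Lcat_cmulE; split=> /=.
  - exact: (identity_dom HC).
  - by have /Lcat_cmulE[_ ->] := ap'.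
  - by rewrite /otimes -{1}(dom_ran HC) (res_eq HG wm) (cprod_ran HC).
have Er : r = p'.
  apply: Lcat_left_cancellative ap'.
  exact: (proj1 (cmulA Lcat_category w apw pu) w0u).
have Es : s = q'.
  apply: Lcat_left_cancellative bq'.
  exact: (proj1 (cmulA Lcat_category w bqw qu) w0u).
exists u; split=> [|v [pv _]]; first by rewrite -Er -Es.
by rewrite -Er in pv; apply: Lcat_left_cancellative pu pv.
Qed.

Lemma Lcat_allowable_pullbacks :
  star_inductive G -> has_allowable_pullbacks (Lcat HG).
Proof.
move=> [_ star] a b ab [c [d [w [acw bdw]]]].
have [m Hm] : exists m, is_meet (ran (Larr a)) (ran (Larr b)) m.
  apply: star; [exact: (ran_identity HC)|exact: (ran_identity HC)|].
  by exists (ran (Larr w)); exact: Lcat_square_ran acw bdw.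
exact: Lcat_pullback ab Hm.
Qed.

Lemma Lcat_pullbacks : inductive G -> has_pullbacks (Lcat HG).
Proof.
move=> [_ ind] a b ab.
have [m] := ind _ _ (ran_identity HC (Larr a)) (ran_identity HC (Larr b)).
exact: Lcat_pullback.
Qed.

End LeftCategoryTheory.

(** * The two constructions are mutually inverse *)

(** Preimages of a composable pair match, so their product exists; its image is the given product
    because products are single-valued. *)
Lemma functor_inverse (C D : arrows) (F : C -> D) (F' : D -> C) :
  category C -> category D -> cancel F F' -> cancel F' F ->
  functor F -> functor F'.
Proof.
move=> HC HD FK FK' [Fd Fr Fc].
have dF y : F' (dom y) = dom (F' y) by rewrite -{1}[y]FK' -Fd FK.
have rF y : F' (ran y) = ran (F' y) by rewrite -{1}[y]FK' -Fr FK.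
split=> // x y z xyz; have /(cmulE HD)[xy _] := xyz.
have [|w xyw] := proj2 (cmul_def HC (F' x) (F' y)).
  by rewrite -dF -rF xy.
have := Fc _ _ _ xyw; rewrite !FK' => /(cmul_fun HD xyz) ->.
by rewrite FK.
Qed.

(** * Recovering an ordered groupoid from its left category *)

Section GroupoidOfLeftCategory.
Variables (G : ordered_arrows) (HG : ordered_groupoid G) (one : G).
Hypotheses (H1 : identity one) (one_max : maximum_identity one).
Let HC : category G := proj1 (og_groupoid HG).
Let root : Lcat HG := Ldiag HG H1.
Let LR : left_rooted root := Lcat_left_rooted HG H1 one_max.
Let LC : category (Lcat HG) := Lcat_category HG.
Implicit Types (X Y Z : Gl root) (a b c d : Lcat HG).

Let ratio a b : G := Larr a ** ginv (Larr b).

Definition Gl_ratio X : G :=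
  ratio (Ufst (class_repr X)) (Usnd (class_repr X)).

Let representsP X a b : represents X a b ->
  [/\ dom (Larr a) = dom (Larr b), Lid a = one & Lid b = one].
Proof.
move=> /representsU[E a1 b1]; split; first exact: (congr1 (@Larr G) E).
  exact: (congr1 (@Lid G) a1).
exact: (congr1 (@Lid G) b1).
Qed.

Let ratio_le X Y a b c d : represents X a b -> represents Y c d ->
  ole X Y <-> ole (ratio a b) (ratio c d).
Proof.
move=> Xab Ycd; have [[ab a1 b1] [cd c1 d1]] := (representsP Xab, representsP Ycd).
rewrite (represents_le LR Xab Ycd) -(ole_ratio HG cd ab).
split=> [[t [/Lcat_dom_ran ct Ea Eb]]|[t [tc Ea Eb]]].
  have /(cmulE LC) : dom c = ran t /\ c ** t = a by split=> //; exact/Lcat_dom_ran.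
  move=> /Lcat_cmulE[_ _ Pa].
  have /(cmulE LC) : dom d = ran t /\ d ** t = b.
    by split=> //; apply/Lcat_dom_ran; rewrite -cd.
  move=> /Lcat_cmulE[_ _ Pb].
  by exists (Larr t); split=> //; rewrite ct; exact: Lran_le.
pose s : Lcat HG := LPair (dom_identity HC (Larr c)) tc.
have /(cmulE LC)[cs csa] : cmul c s a by apply/Lcat_cmulE; rewrite a1 c1.
have /(cmulE LC)[_ dsb] : cmul d s b by apply/Lcat_cmulE; rewrite b1 d1.
by exists s.
Qed.

(** Two representatives of one class give quotients below each other, by reflexivity of the order on
    classes, and antisymmetry in [G] makes them equal. *)
Let ratioE X a b : represents X a b -> Gl_ratio X = ratio a b.
Proof.
move=> Xab; have X0 : represents X (Ufst (class_repr X)) (Usnd (class_repr X)).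
  by exists (class_repr X); rewrite class_reprK.
by apply: (ole_anti HG);
  [apply/(ratio_le X0 Xab) | apply/(ratio_le Xab X0)]; exact: Gl_le_refl.
Qed.

Lemma Gl_ratio_le X Y : ole X Y <-> ole (Gl_ratio X) (Gl_ratio Y).
Proof.
have [a [b Xab]] := represents_exists X; have [c [d Ycd]] := represents_exists Y.
by rewrite (ratioE Xab) (ratioE Ycd); exact: ratio_le.
Qed.

Lemma Gl_ratio_functor : functor Gl_ratio.
Proof.
split.
- move=> X; have [a [b Xab]] := represents_exists X.
  have [ab _ _] := representsP Xab.
  rewrite (ratioE (represents_dom LR Xab)) (ratioE Xab) /ratio (cprodV HG).
  by rewrite (dom_cprod HC) ?(dom_ginv HG) // (ran_ginv HG).
- move=> X; have [a [b Xab]] := represents_exists X.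
  have [ab _ _] := representsP Xab.
  rewrite (ratioE (represents_ran LR Xab)) (ratioE Xab) /ratio (cprodV HG).
  by rewrite (ran_cprod HC) // (ran_ginv HG).
- move=> X Y Z /(Gl_cmulE LR)[a [b [c [Xab Ybc Zac]]]].
  have [[ab _ _] [bc _ _]] := (representsP Xab, representsP Ybc).
  rewrite (ratioE Xab) (ratioE Ybc) (ratioE Zac); apply/(cmulE HC); split.
    by rewrite (dom_cprod HC) ?(ran_cprod HC) ?(dom_ginv HG) // (ran_ginv HG).
  exact: (cprod_ratio HG).
Qed.

Lemma Gl_ratio_surjective x : exists X, Gl_ratio X = x.
Proof.
have le y : ole (ran y) one by apply: (proj2 one_max); exact: (ran_identity HC).
(* An arrow [x] is the quotient of [(1, x)] by [(1, dom x)]; both pairs exist because [1] lies above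
   every range. *)
pose a : Lcat HG := LPair H1 (le x); pose b : Lcat HG := LPair H1 (le (dom x)).
have [|||X Xab] := @represents_mk _ root a b => //.
  by apply: Lpair_eq => /=; rewrite (dom_dom HC).
exists X; rewrite (ratioE Xab) /ratio /=.
have dd : dom x ** ginv (dom x) = dom x by rewrite (cprodV HG) (ran_dom HC).
have <- : dom x = ginv (dom x).
  by rewrite -{1}dd -{1}(dom_dom HC) -(ran_ginv HG) (cprod_ran HC).
exact: (cprod_dom HC).
Qed.

Lemma Gl_Lcat_isomorphic : ordered_isomorphic (Gl root) G.
Proof.
have [F' FK'] := choice Gl_ratio_surjective.
have inj X Y : Gl_ratio X = Gl_ratio Y -> X = Y.
  move=> E; apply: (Gl_le_anti LR); apply/Gl_ratio_le; rewrite E;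
    exact: (ole_refl HG).
have FK : cancel Gl_ratio F' by move=> X; apply: inj; rewrite FK'.
exists Gl_ratio, F'; split; first split=> //.
- exact: Gl_ratio_functor.
- apply: functor_inverse FK FK' Gl_ratio_functor => //.
  exact: (Gl_category LR).
by split=> [X Y /Gl_ratio_le|x y xy] //; apply/Gl_ratio_le; rewrite !FK'.
Qed.

End GroupoidOfLeftCategory.

(** * Recovering a left rooted category up to equivalence *)

Section LeftCategoryOfGroupoid.
Variables (C : arrows) (one : C) (HC1 : left_rooted one).
Variable (HG : ordered_groupoid (Gl one)).
Let HC : category C. Proof. by case: HC1. Qed.
Let HL : left_cancellative C. Proof. by case: HC1. Qed.
Let GC : category (Gl one) := Gl_category HC1.
Let LC : category (Lcat HG) := Lcat_category HG.
Implicit Types (x y z : Lcat HG) (X Y Z E : Gl one) (a b c p q : C).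

(* An identity [E] of [Gl C] is [[b, b]] for [b = arrow_of E], and [dom b] is
   the object of [C] that corresponds to [E]. *)
Let arrow_of E : C := Ufst (class_repr E).

Let arrow_ofP E : identity E -> represents E (arrow_of E) (arrow_of E).
Proof.
move=> iE; have H : represents E (arrow_of E) (Usnd (class_repr E)).
  by exists (class_repr E); rewrite class_reprK.
by have := represents_ran HC1 H; rewrite (identity_ran GC iE).
Qed.

(* [link x p] says [x = (e, X)] with [X = [c p, b]], where [c] and [b] are the
   arrows chosen for [e] and [dom X]; the equivalence sends [x] to [p]. *)
Let link x p : Prop := exists a,
  represents (Larr x) a (arrow_of (dom (Larr x))) /\ cmul (arrow_of (Lid x)) p a.

Let arrow_of_dom X : represents (dom X) (arrow_of (dom X)) (arrow_of (dom X)).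
Proof. exact/arrow_ofP/(dom_identity GC). Qed.

(** After the second entry is moved onto the chosen arrow, the bound of the range of [X] by [e] says
    that the first entry factors through the arrow chosen for [e]; the factor is [p]. *)
Let link_exists x : exists p, link x p.
Proof.
have [a [b Xab]] := represents_exists (Larr x); have [ab _ _] := representsU Xab.
have [u [iu bu Eb _]] := represents_uniq HC1 (represents_dom HC1 Xab)
  (arrow_of_dom (Larr x)).
have Xau := represents_iso HC1 Xab iu (etrans ab bu).
have /(represents_le HC1 (represents_ran HC1 Xau) (arrow_ofP (Lid_identity x)))
  [p [cp Ep _]] := Lran_le x.
exists p, (a ** u); rewrite Eb; split=> //.
by apply/(cmulE HC).
Qed.

Let link_uniq x p q : link x p -> link x q -> p = q.
Proof.
move=> [a [Xa ap]] [b [Xb bq]].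
have ? := represents_snd HC1 Xa Xb; subst b.
exact: HL ap bq.
Qed.

Let link_dom x p : link x p -> dom p = dom (arrow_of (dom (Larr x))).
Proof.
by move=> [a [/representsU[<- _ _] /(dom_cmul HC) ->]].
Qed.

Let link_ran x p : link x p -> ran p = dom (arrow_of (Lid x)).
Proof. by move=> [a [_ /(cmulE HC)[-> _]]]. Qed.

Let link_inj x y p : dom x = dom y -> ran x = ran y ->
  link x p -> link y p -> x = y.
Proof.
move=> dxy rxy [a [Xa ap]] [b [Yb bp]].
have {}dxy : dom (Larr x) = dom (Larr y) := congr1 (@Larr (Gl one)) dxy.
have {}rxy : Lid x = Lid y := congr1 (@Lid (Gl one)) rxy.
apply: Lpair_eq => //; rewrite rxy in ap.
have ? := cmul_fun HC ap bp; subst b.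
by apply: represents_inj Xa _; rewrite dxy.
Qed.

Let link_identity E (iE : identity E) : link (Ldiag HG iE) (dom (arrow_of E)).
Proof.
have H : represents E (arrow_of E) (arrow_of (dom E)).
  by rewrite (identity_dom GC iE); exact: arrow_ofP.
by exists (arrow_of E); split; last exact: (cmul_dom HC).
Qed.

(** With [X = [c p, b]] and [Y = [b q, d]], restricting [X] to the range of [Y] gives
    [[c p q, b q]], and the product with [Y] is [[c p q, d]]. *)
Let link_cmul x y z p q : cmul x y z -> link x p -> link y q ->
  cmul p q (p ** q) /\ link z (p ** q).
Proof.
move=> /Lcat_cmulE[xy zx Pz] lp lq.
have pq : dom p = ran q by rewrite (link_dom lp) (link_ran lq) xy.
split; first exact: (cmul_cprod HC).
have [[a [Xa /(cmulE HC)[cp Ea]]] [b [Yb /(cmulE HC)[bq Eb]]]] := (lp, lq).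
rewrite -xy in bq Eb.
have [ab a1 b1] := representsU Xa.
have aq : dom a = ran q by rewrite ab.
have le : ole (ran (Larr y)) (dom (Larr x)) by exact: Lcat_ran_le.
have [|||R Raq] := @represents_mk C one (a ** q) b.
- by rewrite -Eb !(dom_cprod HC).
- by rewrite (ran_cprod HC).
- by have [_ ->] := representsU Yb.
have RX : ole R (Larr x).
  by apply/(represents_le HC1 Raq Xa); exists q.
have dR : dom R = ran (Larr y).
  exact: represents_inj (represents_dom HC1 Raq) (represents_ran HC1 Yb).
have /(Gl_cmulE HC1)Rz : cmul R (Larr y) (Larr z).
  apply/(cmulE GC); split=> //; rewrite -Pz /otimes -dR.
  by rewrite (res_eq HG RX).
have dz : dom (Larr z) = dom (Larr y) by rewrite -Pz (dom_otimes HG le).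
exists (a ** q); rewrite dz; split; last first.
  apply/(cmulE HC); rewrite zx (ran_cprod HC) //; split=> //.
  by rewrite -(cprodA HC) // Ea.
have [Z RZ /(cmul_fun GC) H] := Gl_cmul HC1 Raq Yb.
by rewrite -(H _ (proj2 (Gl_cmulE HC1 _ _ _) Rz)).
Qed.

Lemma Lcat_Gl_equivalent : equivalent (Lcat HG) C.
Proof.
have [F FP] := choice link_exists.
have Fid E (iE : identity E) : F (Ldiag HG iE) = dom (arrow_of E).
  by apply: link_uniq (FP _) _; exact: link_identity.
have FidL x : identity x -> F x = dom (arrow_of (Larr x)).
  move=> ix; rewrite -{1}(identity_dom LC ix) Fid.
  by rewrite -[in RHS](identity_dom LC ix).
exists F; split.
- split=> [x|x|x y z xyz]; first by rewrite Fid (link_dom (FP x)).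
    by rewrite Fid (link_ran (FP x)).
  have [H lz] := link_cmul xyz (FP x) (FP y).
  by rewrite (link_uniq (FP z) lz).
- move=> e f p ie jf; rewrite (FidL _ ie) (FidL _ jf) => dp rp.
  have iE : identity (Larr e).
    by rewrite (identity_LcatE ie); exact: Lid_identity.
  have jF : identity (Larr f).
    by rewrite (identity_LcatE jf); exact: Lid_identity.
  have [Ee Ff] := (arrow_ofP iE, arrow_ofP jF).
  have [[_ e1 _] [_ f1 _]] := (representsU Ee, representsU Ff).
  have fp : dom (arrow_of (Larr f)) = ran p by [].
  (* With [c] and [b] the arrows chosen for [f] and [e], the arrow [p] lifts to [(f, [c p, b])]. *)
  have [|||X Xp] :=
    @represents_mk C one (arrow_of (Larr f) ** p) (arrow_of (Larr e)).
  + by rewrite (dom_cprod HC).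
  + by rewrite (ran_cprod HC).
  + by [].
  have dX : dom X = Larr e := represents_inj (represents_dom HC1 Xp) Ee.
  have rX : ole (ran X) (Larr f).
    by apply/(represents_le HC1 (represents_ran HC1 Xp) Ff); exists p.
  pose x : Lcat HG := LPair jF rX.
  exists x; split.
  + by apply: Lpair_eq; rewrite -?(identity_LcatE ie); exact: dX.
  + by apply: Lpair_eq; rewrite -?(identity_LcatE jf).
  apply: link_uniq (FP x) _; exists (arrow_of (Larr f) ** p).
  by rewrite -dX in Xp; split=> //; exact: (cmul_cprod HC).
- move=> x y dxy rxy Fxy; apply: (link_inj dxy rxy (FP x)).
  by rewrite Fxy; exact: FP.
(* An arrow [a] from [f] to [one] gives the identity [[a, a]]. The arrow chosen for it is [a ** u]
   with [u] an isomorphism onto [f], so [u] links the image of [[a, a]] to [f]. *)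
move=> f jf; have [_ _ [_ wt]] := HC1; have [a [da ra]] := wt f jf.
have [|||X Xa] := @represents_mk C one a a => //.
have iX := represents_identity HC1 Xa.
have [u [iu au Eu _]] := represents_uniq HC1 Xa (arrow_ofP iX).
exists (Ldiag HG iX), u; split.
- exact: Ldiag_identity.
- exact: iu.
- by rewrite Fid Eu (dom_cprod HC).
- by rewrite -au.
Qed.

End LeftCategoryOfGroupoid.

(** * Inverse monoids *)

Section InverseMonoid.
Variables (S : Type) (mul : S -> S -> S) (one : S) (inv : S -> S).
Hypothesis HS : inverse_monoid mul one inv.
Implicit Types (s t u v e f : S).

Local Notation "s * t" := (mul s t).
Local Notation "s ^-1" := (inv s).

Let mulA s t u : s * (t * u) = s * t * u. Proof. exact: (im_assoc HS). Qed.
Let mul1 s : one * s = s. Proof. exact: (im_left_id HS). Qed.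
Let mulr1 s : s * one = s. Proof. exact: (im_right_id HS). Qed.
Let mulVK s : s * (s^-1 * s) = s. Proof. by rewrite mulA (im_mulVK HS). Qed.
(** The variants ending in [t] let a cancellation act inside a right-associated word, the normal
    form used below. *)
Let mulVKt s t : s * (s^-1 * (s * t)) = s * t.
Proof. by rewrite !mulA (im_mulVK HS). Qed.
Let VmulK s : s^-1 * (s * s^-1) = s^-1. Proof. by rewrite mulA (im_VmulK HS). Qed.
Let VmulKt s t : s^-1 * (s * (s^-1 * t)) = s^-1 * t.
Proof. by rewrite !mulA (im_VmulK HS). Qed.
Let idemt e t : e * e = e -> e * (e * t) = e * t.
Proof. by move=> ee; rewrite mulA ee. Qed.

Let inv_uniq s t : s * (t * s) = s -> t * (s * t) = t -> t = s^-1.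
Proof. by rewrite !mulA; exact: (im_inv_uniq HS). Qed.

Lemma im_idem_inv e : e * e = e -> e^-1 = e.
Proof. by move=> ee; apply/esym/inv_uniq; rewrite !ee. Qed.

Lemma im_invK s : s^-1^-1 = s.
Proof. exact/esym/inv_uniq. Qed.

Lemma im_idemVm s : (s^-1 * s) * (s^-1 * s) = s^-1 * s.
Proof. by rewrite -mulA mulVK. Qed.

Lemma im_idemmV s : (s * s^-1) * (s * s^-1) = s * s^-1.
Proof. by rewrite -mulA VmulK. Qed.

(* [f (ef)^-1 e] is an inverse of [ef] and is idempotent, so [ef] is idempotent. *)
Lemma im_idem_mul e f : e * e = e -> f * f = f -> (e * f) * (e * f) = e * f.
Proof.
move=> ee ff; set x := (e * f)^-1.
have exf : e * (f * (x * (e * f))) = e * f by rewrite mulA mulVK.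
have xex t : x * (e * (f * (x * t))) = x * t by rewrite (mulA e) VmulKt.
have E : f * (x * e) = x.
  by apply: inv_uniq; rewrite -!mulA !idemt // xex.
have xx : x * x = x by rewrite -{1 2}E -!mulA xex.
have <- : x = e * f by rewrite -(im_invK (e * f)) (im_idem_inv xx).
exact: xx.
Qed.

(** Both products are idempotent, so [f * e] is an inverse of [e * f], which is its own inverse. *)
Lemma im_idemC e f : e * e = e -> f * f = f -> e * f = f * e.
Proof.
move=> ee ff; have ef := im_idem_mul ee ff; have fe := im_idem_mul ff ee.
rewrite -(im_idem_inv ef); apply/esym/inv_uniq.
  by rewrite -!mulA !idemt // mulA.
by rewrite -!mulA !idemt // mulA.
Qed.

Let idemCt e f t : e * e = e -> f * f = f -> e * (f * t) = f * (e * t).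
Proof. by move=> ee ff; rewrite !mulA (im_idemC ee ff). Qed.

(** The idempotents [t * t^-1] and [s^-1 * s] commute, which brings each inverse next to the element
    it cancels. *)
Lemma im_invM s t : (s * t)^-1 = t^-1 * s^-1.
Proof.
have C u : t * (t^-1 * (s^-1 * (s * u))) = s^-1 * (s * (t * (t^-1 * u))).
  by rewrite (mulA t) (mulA s^-1) idemCt ?im_idemmV ?im_idemVm // -!mulA.
apply/esym/inv_uniq; rewrite -!mulA.
  by rewrite C mulVKt mulVK.
have {}C u : s^-1 * (s * (t * (t^-1 * u))) = t * (t^-1 * (s^-1 * (s * u))).
  by rewrite C.
by rewrite C VmulKt VmulK.
Qed.

(** The idempotent can always be chosen as the domain of [s], so elements below [t] are determined
    by their domains; this is uniqueness of restrictions. *)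
Lemma natural_leE s t : natural_le mul s t <-> s = t * (s^-1 * s).
Proof.
split=> [[e [ee ->]]|E]; last by exists (s^-1 * s); rewrite im_idemVm.
rewrite im_invM (im_idem_inv ee) -!mulA (mulA t^-1) (idemCt _ ee (im_idemVm t)).
by rewrite ee -mulA mulVKt.
Qed.

(** Conjugation carries an idempotent from the left of [t] to its right: the witness is
    [t^-1 * (f * t)]. It makes the order left-right symmetric. *)
Lemma natural_le_left f t : f * f = f -> natural_le mul (f * t) t.
Proof.
move=> ff; exists (t^-1 * (f * t)); split.
  rewrite -!mulA (mulA t) (idemCt _ ff (im_idemmV t)) idemt //.
  by rewrite -!mulA VmulKt.
by rewrite (mulA t) (idemCt _ (im_idemmV t) ff) -mulA mulVK.
Qed.

Lemma natural_leE_left s t : natural_le mul s t <-> s = (s * s^-1) * t.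
Proof.
split=> [[e [ee ->]]|->]; last exact/natural_le_left/im_idemmV.
rewrite im_invM (im_idem_inv ee) -!mulA idemt // (im_idemC ee (im_idemVm t)).
by rewrite -mulA mulVKt.
Qed.

Lemma natural_le_refl s : natural_le mul s s.
Proof. by apply/natural_leE; rewrite mulVK. Qed.

Lemma natural_le_anti s t : natural_le mul s t -> natural_le mul t s -> s = t.
Proof.
move=> [e [ee Es]] [f [ff Et]]; have tef : t = t * (e * f) by rewrite mulA -Es.
by rewrite Es {1}tef (im_idemC ee ff) -!mulA ee -(im_idemC ee ff).
Qed.

Lemma natural_le_trans s t u :
  natural_le mul s t -> natural_le mul t u -> natural_le mul s u.
Proof.
move=> [e [ee ->]] [f [ff ->]]; exists (f * e).
by split; [exact: im_idem_mul | rewrite mulA].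
Qed.

Lemma natural_le_inv s t : natural_le mul s t -> natural_le mul s^-1 t^-1.
Proof.
move=> [e [ee ->]]; rewrite im_invM (im_idem_inv ee); exact: natural_le_left.
Qed.

Lemma natural_le_mul s t u v :
  natural_le mul s t -> natural_le mul u v -> natural_le mul (s * u) (t * v).
Proof.
move=> [e [ee ->]] [f [ff ->]].
have [g [gg E]] := natural_le_left v ee.
by exists (g * f); split; [exact: im_idem_mul | rewrite -!mulA (mulA e) E -!mulA].
Qed.

(** * The ordered groupoid of an inverse monoid, with or without its zero *)

Section RestrictedGroupoid.
Variables (H : ordered_arrows) (iota : H -> S).
Implicit Types x y z : H.

(* [H] is the ordered groupoid of the elements of [S] outside a possibly empty
   ideal: the empty ideal gives [groupoid_of], the zero ideal [nonzero_groupoid]. *)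
Record ideal_complement : Prop := IdealComplement {
  ic_inj : injective iota;
  ic_dom : forall x, iota (dom x) = (iota x)^-1 * iota x;
  ic_ran : forall x, iota (ran x) = iota x * (iota x)^-1;
  ic_cmul : forall x y z, cmul x y z <->
    (iota x)^-1 * iota x = iota y * (iota y)^-1 /\ iota z = iota x * iota y;
  ic_le : forall x y, ole x y <-> natural_le mul (iota x) (iota y);
  ic_ideal : forall u s v h, iota h = u * (s * v) -> exists x, iota x = s }.

Hypothesis HH : ideal_complement.

Lemma ic_idem_identity x : iota x * iota x = iota x -> identity x.
Proof.
move=> xx; split=> y z /(ic_cmul HH)[E P]; apply: (ic_inj HH); rewrite P.
  by move: E; rewrite (im_idem_inv xx) xx => ->; rewrite -mulA mulVK.
by move: E; rewrite (im_idem_inv xx) xx => <-; rewrite mulVK.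
Qed.
Lemma ic_dom_idem x : iota (dom x) * iota (dom x) = iota (dom x).
Proof. by rewrite (ic_dom HH) im_idemVm. Qed.

Lemma ic_ran_idem x : iota (ran x) * iota (ran x) = iota (ran x).
Proof. by rewrite (ic_ran HH) im_idemmV. Qed.

Lemma ic_category : category H.
Proof.
split.
- move=> x y z z' /(ic_cmul HH)[_ E] /(ic_cmul HH)[_ E'].
  by apply: (ic_inj HH); rewrite E.
- move=> x y; split=> [[z /(ic_cmul HH)[E _]]|/(congr1 iota)].
    by apply: (ic_inj HH); rewrite (ic_dom HH) (ic_ran HH).
  rewrite (ic_dom HH) (ic_ran HH) => E.
  (* When domain and range match, multiplying [xy] by [x^-1] on the left and [y^-1] on the right
     recovers [dom x], so [xy] cannot fall into the ideal. *)
  have [|z Ez] := @ic_ideal HH (iota x)^-1 (iota x * iota y) (iota y)^-1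
    (dom x).
    by rewrite (ic_dom HH) -!mulA -E mulVK.
  by exists z; apply/(ic_cmul HH).
- by move=> x; apply: ic_idem_identity; exact: ic_dom_idem.
- by move=> x; apply: ic_idem_identity; exact: ic_ran_idem.
- move=> x; apply/(ic_cmul HH); rewrite (ic_dom HH) mulVK; split=> //.
  by rewrite im_invM im_invK im_idemVm.
- move=> x; apply/(ic_cmul HH); rewrite (ic_ran HH) -mulA mulVK; split=> //.
  by rewrite im_invM im_invK im_idemmV.
- move=> x y z /(ic_cmul HH)[E P]; apply: (ic_inj HH).
  by rewrite !(ic_dom HH) P im_invM -!mulA (mulA (iota x)^-1) E -mulA mulVK.
- move=> x y z /(ic_cmul HH)[E P]; apply: (ic_inj HH).
  by rewrite !(ic_ran HH) P im_invM -!mulA (mulA (iota y)) -E -mulA VmulK.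
move=> x y z xy yz w /(ic_cmul HH)[E P] /(ic_cmul HH)[F Q].
have xyz : (iota xy)^-1 * iota xy = iota z * (iota z)^-1.
  by rewrite P im_invM -F -!mulA (mulA (iota x)^-1) E -mulA mulVK.
have xyz' : (iota x)^-1 * iota x = iota yz * (iota yz)^-1.
  by rewrite Q im_invM E -!mulA (mulA (iota z)) -F -mulA VmulK.
by split=> /(ic_cmul HH)[_ R]; apply/(ic_cmul HH); split=> //; rewrite R P Q mulA.
Qed.

Lemma ic_identity_idem x : identity x -> iota x * iota x = iota x.
Proof. by move=> /(identity_dom ic_category) <-; exact: ic_dom_idem. Qed.

Lemma ic_inverse_of x y : inverse_of x y <-> iota y = (iota x)^-1.
Proof.
split=> [[/(ic_cmul HH)[E P] /(ic_cmul HH)[F Q]]|E].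
  by apply: inv_uniq; [rewrite -Q (ic_dom HH)|rewrite -P (ic_ran HH) -F];
    rewrite mulVK.
by split; apply/(ic_cmul HH); rewrite ?(ic_dom HH) ?(ic_ran HH) E im_invK.
Qed.

Lemma ic_ordered_groupoid : ordered_groupoid H.
Proof.
split.
- split=> [|x]; first exact: ic_category.
  have [|y Ey] := @ic_ideal HH (iota x) (iota x)^-1 (iota x) x.
    by rewrite mulVK.
  by exists y; apply/ic_inverse_of.
- by move=> x; apply/(ic_le HH); exact: natural_le_refl.
- move=> x y /(ic_le HH) xy /(ic_le HH) yx; apply: (ic_inj HH).
  exact: natural_le_anti.
- move=> x y z /(ic_le HH) xy /(ic_le HH) yz; apply/(ic_le HH).
  exact: natural_le_trans xy yz.
- move=> x y x' y' /(ic_le HH) xy /ic_inverse_of Ex /ic_inverse_of Ey.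
  by apply/(ic_le HH); rewrite Ex Ey; exact: natural_le_inv.
- move=> x y u v xu yv /(ic_le HH) xy /(ic_le HH) uv.
  move=> /(ic_cmul HH)[_ P] /(ic_cmul HH)[_ Q].
  by apply/(ic_le HH); rewrite P Q; exact: natural_le_mul.
- move=> x e /ic_identity_idem ee /(ic_le HH)/natural_leE.
  rewrite (ic_dom HH) (im_idem_inv ee) ee => E.
  have [|y Ey] := @ic_ideal HH (iota x)^-1 (iota x * iota e) one e.
    by rewrite mulr1 mulA.
  have le : ole y x by apply/(ic_le HH); rewrite Ey; exists (iota e).
  exists y; split.
    split=> //; apply: (ic_inj HH).
    by rewrite (ic_dom HH) Ey im_invM (im_idem_inv ee) -mulA (mulA (iota x)^-1) -E.
  move=> z [/(ic_le HH)/natural_leE zx ze]; apply: (ic_inj HH).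
  by rewrite Ey zx -(ic_dom HH) ze.
- move=> x e /ic_identity_idem ee /(ic_le HH)/natural_leE_left.
  rewrite (ic_ran HH) (im_idem_inv ee) ee => E.
  have [|y Ey] := @ic_ideal HH one (iota e * iota x) (iota x)^-1 e.
    by rewrite mul1 -mulA.
  have le : ole y x by apply/(ic_le HH); rewrite Ey; exact: natural_le_left.
  exists y; split.
    split=> //; apply: (ic_inj HH).
    by rewrite (ic_ran HH) Ey im_invM (im_idem_inv ee) mulA -(mulA (iota e)) -E.
  move=> z [/(ic_le HH)/natural_leE_left zx ze]; apply: (ic_inj HH).
  by rewrite Ey zx -(ic_ran HH) ze.
Qed.

Lemma ic_is_meet x y z : identity x -> identity y ->
  iota z = iota x * iota y -> is_meet x y z.
Proof.
move=> /ic_identity_idem xx /ic_identity_idem yy Ez; split.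
- by apply: ic_idem_identity; rewrite Ez im_idem_mul.
- by apply/(ic_le HH); exists (iota y).
- by apply/(ic_le HH); exists (iota x); rewrite Ez (im_idemC xx yy).
move=> n /ic_identity_idem nn /(ic_le HH)/natural_leE nx /(ic_le HH)/natural_leE ny.
apply/(ic_le HH)/natural_leE; move: nx ny.
by rewrite (im_idem_inv nn) nn Ez -mulA => nx <-.
Qed.

(** A common lower bound satisfies [n = x y n], so [x y] divides an element outside the ideal and
    lies outside it too. *)
Lemma ic_lower_bound x y n : ole n x -> ole n y -> identity n ->
  exists z, iota z = iota x * iota y.
Proof.
move=> /(ic_le HH)/natural_leE nx /(ic_le HH)/natural_leE ny /ic_identity_idem nn.
apply: (@ic_ideal HH one _ (iota n) n); move: nx ny.
by rewrite (im_idem_inv nn) nn mul1 -mulA => nx <-.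
Qed.

Lemma ic_star_inductive : star_inductive H.
Proof.
split=> [|x y ix iy [n [jn nx ny]]]; first exact: ic_ordered_groupoid.
have [z Ez] := ic_lower_bound nx ny jn.
by exists z; exact: ic_is_meet.
Qed.

(** The two restrictions multiply to [x e y] with [e] the product of [dom x] and [ran y], and [x]
    and [y] absorb [e]. Conversely, [xy = x e y] outside the ideal forces [e] outside it, so the
    meet and the pseudoproduct exist. *)
Lemma ic_pseudoproduct x y z : pseudoproduct x y z <-> iota z = iota x * iota y.
Proof.
have OG := ic_ordered_groupoid; have HC := ic_category.
have idr := dom_identity HC x; have iry := ran_identity HC y.
have fwd w : pseudoproduct x y w -> iota w = iota x * iota y.
  move=> [e [x' [y' [[ie ex ey eM] [x'x x'e] [y'y y'e] /(ic_cmul HH)[_ ->]]]]].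
  have [m Em] := ic_lower_bound ex ey ie.
  have Ee : e = m.
    by apply: (is_meet_uniq OG (e := dom x) (f := ran y)) => //; exact: ic_is_meet.
  have ee := ic_identity_idem ie; rewrite -Ee in Em.
  move/(ic_le HH)/natural_leE: x'x => ->.
  move/(ic_le HH)/natural_leE_left: y'y => ->.
  rewrite -(ic_dom HH) -(ic_ran HH) x'e y'e -mulA idemt // Em.
  by rewrite (ic_dom HH) (ic_ran HH) -!mulA mulVKt mulVK.
split=> [|Ez]; first exact: fwd.
have [e Ee] : exists e : H, iota e = iota (dom x) * iota (ran y).
  apply: (@ic_ideal HH (iota x) _ (iota y) z).
  by rewrite Ez (ic_dom HH) (ic_ran HH) -!mulA mulVKt mulVK.
have me := ic_is_meet idr iry Ee.
have [ie ex ey _] := me.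
have Rx := resP OG ie ex; have Cy := coresP OG ie ey.
have [w Pw] : exists w, pseudoproduct x y w.
  exists (cprod (res x e) (cores e y)), e, (res x e), (cores e y); split=> //.
  by apply: (cmul_cprod HC); rewrite (proj2 Rx) (proj2 Cy).
suff -> : z = w by [].
by apply: (ic_inj HH); rewrite (fwd _ Pw).
Qed.

Lemma ic_maximum_identity x : iota x = one -> maximum_identity x.
Proof.
move=> x1; split; first by apply: ic_idem_identity; rewrite x1 mul1.
move=> e /ic_identity_idem ee; apply/(ic_le HH); rewrite x1.
by exists (iota e); rewrite mul1.
Qed.

End RestrictedGroupoid.

Lemma groupoid_of_ideal_complement : @ideal_complement (groupoid_of mul inv) id.
Proof. by split=> // u s v h _; exists s. Qed.

Lemma groupoid_of_inductive : inductive (groupoid_of mul inv).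
Proof.
have IC := groupoid_of_ideal_complement.
split=> [|e f ie jf]; first exact: ic_ordered_groupoid IC.
by exists (e * f); exact: (ic_is_meet IC).
Qed.

Lemma nonzero_ideal_complement (zero : S) (Hzero : is_zero mul zero) :
  @ideal_complement (nonzero_groupoid HS Hzero) (@sval S (fun s => s <> zero)).
Proof.
split=> //.
- by move=> x y /eq_sig_hprop; apply; move=> s; exact: Prop_irrelevance.
move=> u s v h E; have s0 : s <> zero.
  move=> s0; apply: (svalP h); rewrite E s0 (proj1 Hzero); exact: (proj2 Hzero).
by exists (exist _ s s0).
Qed.

Lemma inverse_monoid_transport (T : Type) (mulT : T -> T -> T) (f : S -> T)
    (g : T -> S) : cancel f g -> cancel g f ->
  {morph f : x y / x * y >-> mulT x y} ->
  inverse_monoid mulT (f one) (fun y : T => f (g y)^-1).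
Proof.
move=> fK gK fM; have gM (t t' : T) : g (mulT t t') = g t * g t'.
  by rewrite -{1}[t]gK -{1}[t']gK -fM fK.
split.
- by move=> t t' t''; apply: (can_inj gK); rewrite !gM mulA.
- by move=> t; apply: (can_inj gK); rewrite gM fK mul1.
- by move=> t; apply: (can_inj gK); rewrite gM fK mulr1.
- by move=> t; apply: (can_inj gK); rewrite !gM fK -mulA mulVK.
- by move=> t; apply: (can_inj gK); rewrite !gM fK -mulA VmulK.
move=> t t' E F; apply: (can_inj gK); rewrite fK.
by apply: (im_inv_uniq HS); rewrite -!gM ?E ?F.
Qed.

End InverseMonoid.

(** * Transport of meets and pseudoproducts along an ordered isomorphism *)

Lemma functor_identity (C D : arrows) (F : C -> D) (e : C) :
  category C -> category D -> functor F -> identity e -> identity (F e).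
Proof.
move=> HC HD Ff /(identity_dom HC) <-.
by rewrite (functor_dom Ff); exact: (dom_identity HD).
Qed.

Section OrderedIsomorphism.
Variables (G H : ordered_arrows) (F : G -> H) (F' : H -> G).
Hypotheses (HG : ordered_groupoid G) (HH : ordered_groupoid H).
Hypotheses (FK : cancel F F') (FK' : cancel F' F).
Hypotheses (Ff : functor F) (Ff' : functor F').
Hypotheses (Fle : {homo F : x y / ole x y}) (Fle' : {homo F' : x y / ole x y}).
Let GC : category G := proj1 (og_groupoid HG).
Let HC : category H := proj1 (og_groupoid HH).

Lemma iso_is_meet e f m : is_meet e f m -> is_meet (F e) (F f) (F m).
Proof.
move=> [im me mf mM]; split.
- exact: functor_identity im.
- exact: Fle.
- exact: Fle.
move=> n jn /Fle' ne /Fle' nf; rewrite FK in ne; rewrite FK in nf.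
rewrite -[n]FK'; apply/Fle/mM => //.
exact: functor_identity jn.
Qed.

Lemma iso_pseudoproduct x y z :
  pseudoproduct x y z -> pseudoproduct (F x) (F y) (F z).
Proof.
move=> [e [x' [y' [me [x'x x'e] [y'y y'e] xyz]]]].
exists (F e), (F x'), (F y'); split.
- by rewrite -(functor_dom Ff) -(functor_ran Ff); exact: iso_is_meet.
- by split; [exact: Fle|rewrite -(functor_dom Ff) x'e].
- by split; [exact: Fle|rewrite -(functor_ran Ff) y'e].
exact: (functor_cmul Ff).
Qed.

Lemma iso_maximum_identity e : maximum_identity e -> maximum_identity (F e).
Proof.
move=> [ie emax]; split=> [|f jf]; first exact: functor_identity ie.
by rewrite -[f]FK'; apply/Fle/emax; exact: functor_identity jf.
Qed.

Lemma iso_star_inductive : star_inductive G -> star_inductive H.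
Proof.
move=> [_ star]; split=> // e f ie jf [n [kn /Fle' ne /Fle' nf]].
have FI x : identity x -> identity (F' x) by exact: functor_identity.
have [||| m Hm] := star (F' e) (F' f); [exact: FI|exact: FI| |].
  by exists (F' n); split=> //; exact: FI.
by exists (F m); rewrite -[e]FK' -[f]FK'; exact: iso_is_meet.
Qed.

Lemma iso_inductive : inductive G -> inductive H.
Proof.
move=> [_ ind]; split=> // e f ie jf.
have FI x : identity x -> identity (F' x) by exact: functor_identity.
have [m Hm] := ind _ _ (FI _ ie) (FI _ jf).
by exists (F m); rewrite -[e]FK' -[f]FK'; exact: iso_is_meet.
Qed.

End OrderedIsomorphism.

Lemma pseudoproduct0P (G : ordered_arrows) (x y : G) :
  (exists2 z, pseudoproduct x y z & pseudoproduct0 (Some x) (Some y) = Some z) \/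
  (~ (exists z, pseudoproduct x y z)) /\ pseudoproduct0 (Some x) (Some y) = None.
Proof.
rewrite /pseudoproduct0; case: pselect => [h|]; last by right.
by left; exists (sval (cid h)) => //; case: cid.
Qed.

Theorem theorem3p14 :
  (* (1) *)
  (forall (G : ordered_arrows) (HG : ordered_groupoid G) (one : G),
     maximum_identity one ->
     exists root : Lcat HG,
       [/\ Lid root = one, Larr root = one, left_rooted root &
           ordered_isomorphic (Gl root) G]) /\
  (* (2) *)
  (forall (C : arrows) (one : C),
     left_rooted one ->
     exists (HG : ordered_groupoid (Gl one)) (m : Gl one) (root : Lcat HG),
       [/\ maximum_identity (G := Gl one) m, Lid root = m, Larr root = m,
           left_rooted root & equivalent (Lcat HG) C]) /\
  (* (3) *)
  (forall (S : Type) (mul : S -> S -> S) (one : S) (inv : S -> S) (zero : S)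
          (HS : inverse_monoid mul one inv) (Hzero : is_zero mul zero),
     one <> zero ->
     exists (HG : ordered_groupoid (nonzero_groupoid HS Hzero))
            (root : Lcat HG),
       [/\ sval (Lid root) = one, sval (Larr root) = one, left_rooted root,
           has_allowable_pullbacks (Lcat HG) & star_inductive (Gl root)] /\
       exists (m : Gl root) (inv' : option (Gl root) -> option (Gl root))
              (f : S -> option (Gl root)),
         [/\ maximum_identity (G := Gl root) m,
             inverse_monoid (@pseudoproduct0 (Gl root)) (Some m) inv',
             is_zero (@pseudoproduct0 (Gl root)) None,
             monoid_isomorphism mul one
               (@pseudoproduct0 (Gl root)) (Some m) f &
             f zero = None]) /\
  (* (4) *)
  (forall (S : Type) (mul : S -> S -> S) (one : S) (inv : S -> S)
          (HS : inverse_monoid mul one inv),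
     exists (HG : ordered_groupoid (groupoid_of mul inv)) (root : Lcat HG),
       [/\ Lid root = one, Larr root = one, left_rooted root,
           has_pullbacks (Lcat HG) & inductive (Gl root)] /\
       exists (m : Gl root) (mul' : Gl root -> Gl root -> Gl root)
              (inv' : Gl root -> Gl root) (f : S -> Gl root),
         [/\ maximum_identity (G := Gl root) m,
             forall x y, pseudoproduct (G := Gl root) x y (mul' x y),
             inverse_monoid mul' m inv' &
             monoid_isomorphism mul one mul' m f]).

Proof.
split; last split; last split.
- move=> G HG one max1; have H1 := proj1 max1.
  exists (Ldiag HG H1); split=> //; first exact: Lcat_left_rooted.
  exact: Gl_Lcat_isomorphic.
- move=> C one HC1; have HG := Gl_ordered_groupoid HC1.
  have [M M1] := represents_maximum_exists HC1.
  have Mmax := represents_maximum HC1 M1.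
  exists HG, M, (Ldiag HG (proj1 Mmax)); split=> //.
    exact: Lcat_left_rooted.
  exact: Lcat_Gl_equivalent HC1 HG.
- move=> S mul one inv zero HS Hzero one0.
  have IC := nonzero_ideal_complement HS Hzero.
  have HG := ic_ordered_groupoid HS IC.
  (* The assumption [one <> zero] keeps the unit among the nonzero elements, where it becomes the
     maximum identity. *)
  pose one' : nonzero_groupoid HS Hzero := exist (fun s => s <> zero) one one0.
  have max1 : maximum_identity one' by exact: (ic_maximum_identity HS IC).
  pose root : Lcat HG := Ldiag HG (proj1 max1).
  have LR : left_rooted root := Lcat_left_rooted HG (proj1 max1) max1.
  have HL := Gl_ordered_groupoid LR.
  have star := ic_star_inductive HS IC.
  have [F [F' [[FK FK' Ff Ff'] [Fle Fle']]]] :=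
    Gl_Lcat_isomorphic HG (proj1 max1) max1.
  exists HG, root; split.
    split=> //; first exact: Lcat_allowable_pullbacks.
    exact: iso_star_inductive FK' FK Ff' Ff Fle' Fle star.
  pose f s :=
    if pselect (s = zero) is right s0 then Some (F' (exist _ s s0)) else None.
  pose g X := if X is Some Y then sval (F Y) else zero.
  have fK : cancel f g.
    by move=> s; rewrite /f; case: pselect => [->//|s0]; rewrite /g FK'.
  have gK : cancel g f.
    move=> [X|]; rewrite /f /g; case: pselect => // [E|s0].
      by case: (svalP (F X)).
    by congr Some; apply: (can_inj FK); rewrite FK'; exact: (ic_inj IC).
  have gM X Y : g (pseudoproduct0 X Y) = mul (g X) (g Y).
    case: X Y => [X|] [Y|];
      try by rewrite /= ?(proj1 Hzero) ?(proj2 Hzero).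
    have [[Z XYZ ->]|[nXY ->]] := pseudoproduct0P X Y.
      by apply/(ic_pseudoproduct HS IC); exact: iso_pseudoproduct XYZ.
    (* A nonzero product in the monoid would be a pseudoproduct, so an undefined pseudoproduct
       corresponds exactly to a zero product. *)
    apply: contrapT => /nesym p0; apply: nXY.
    pose p : nonzero_groupoid HS Hzero := exist (fun s => s <> zero) _ p0.
    have /(ic_pseudoproduct HS IC) P : sval p = mul (sval (F X)) (sval (F Y)) by [].
    by exists (F' p); rewrite -[X]FK -[Y]FK; exact: iso_pseudoproduct P.
  have fM : {morph f : x y / mul x y >-> pseudoproduct0 x y}.
    by move=> s t; apply: (can_inj gK); rewrite gM !fK.
  have f1 : f one = Some (F' one') by apply: (can_inj gK); rewrite fK /= FK'.
  exists (F' one'), (fun X => f (inv (g X))), f; split.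
  + exact: (iso_maximum_identity HG HL FK Ff' Ff Fle' max1).
  + by rewrite -f1; exact: (inverse_monoid_transport HS).
  + by split=> [|[]].
  + by split=> //; exists g.
  + by apply: (can_inj gK); rewrite fK.
move=> S mul one inv HS.
have IC := groupoid_of_ideal_complement mul inv.
have ind := groupoid_of_inductive HS.
have HG := proj1 ind.
have max1 : maximum_identity (one : groupoid_of mul inv).
  exact: (ic_maximum_identity HS IC).
pose root : Lcat HG := Ldiag HG (proj1 max1).
have LR : left_rooted root := Lcat_left_rooted HG (proj1 max1) max1.
have HL := Gl_ordered_groupoid LR.
have [F [F' [[FK FK' Ff Ff'] [Fle Fle']]]] :=
    Gl_Lcat_isomorphic HG (proj1 max1) max1.
exists HG, root; split.
  split=> //; first exact: Lcat_pullbacks.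
  exact: iso_inductive FK' FK Ff' Ff Fle' Fle ind.
(* The multiplication is transported from [S]; it computes pseudoproducts because those of [S] are
   its products and [F'] preserves them. *)
pose mul' X Y := F' (mul (F X) (F Y)).
have F'M : {morph F' : x y / mul x y >-> mul' x y} by move=> s t; rewrite /mul' !FK'.
exists (F' one), mul', (fun X => F' (inv (F X))), F'; split.
- exact: (iso_maximum_identity HG HL FK Ff' Ff Fle' max1).
- move=> X Y; have P : pseudoproduct (F X) (F Y) (mul (F X) (F Y)).
    exact/(ic_pseudoproduct HS IC).
  by rewrite -{1}[X]FK -{1}[Y]FK; exact: iso_pseudoproduct P.
- exact: (inverse_monoid_transport HS).
- by split=> //; exists F.
Qed.
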